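(* Let $G$ be a finite group and $G^- = \{ g \in G : \langle g \rangle \text{ is not a maximal cyclic subgroup of } G\}$. Then: (1) If $N$ is a normal subgroup of $G$, then $G^- \subseteq N$ if and only if every element of $G \setminus N$ has prime power order and every nonidentity element of $G/N$ has prime order. In particular (when $G^- \subseteq N$), $G/N$ is either a $p$-group of exponent $p$, or a Frobenius group whose Frobenius kernel is a $p$-group of exponent $p$ and whose Frobenius complement has order $q$ for some prime $q \ne p$, or isomorphic to $A_5$. (2) If $M$ is a normal subgroup of $G$ and $p$ is a prime with $|G:M| = p$, then $G^- \subseteq M$ if and only if every element of $G \setminus M$ has $p$-power order. (3) If $G$ is a $p$-group and $N$ is a normal subgroup of $G$ such that $G/N$ has exponent $p$, then $G^- \subseteq N$.
   Context: A cyclic subgroup $C$ of $G$ is maximal cyclic if there is no cyclic subgroup $D$ of $G$ with $C < D$.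
   Formalization: In (1), ''p-group of exponent p'' is stated as a p-group whose exponent divides p, since for N = G the quotient G/N is trivial with exponent 1; for nontrivial G/N this means exponent exactly p. *)

(* Defs.v *)
From mathcomp Require Import all_boot all_order all_fingroup all_solvable.
Set Implicit Arguments. Unset Strict Implicit. Unset Printing Implicit Defensive.
Import GroupScope.
Local Open Scope group_scope.

Definition max_cyclic (gT : finGroupType) (G C : {set gT}) : bool :=
  [&& C \subset G, group_set C, cyclic C &
      [forall D : {group gT}, ((D \subset G) && cyclic D) ==> ~~ (C \proper D)]].

Definition Gminus (gT : finGroupType) (G : {set gT}) : {set gT} :=
  [set g in G | ~~ max_cyclic G <[g]>].

(* Main.v *)
Require Import Defs.
From mathcomp Require Import all_boot all_order all_fingroup all_solvable.
From mathcomp Require Import all_algebra all_field all_character ring zify.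
Import Order.TTheory GRing.Theory Num.Theory FiniteModule GroupScope.
Local Open Scope group_scope.
Set Implicit Arguments. Unset Strict Implicit. Unset Printing Implicit Defensive.

(* The element g lies in Gminus G exactly when <[g]> < <[h]> for some h in G.
   If Gminus G is contained in N and g in G \ N did not have prime power order,
   its p-part and p'-part would generate proper subgroups of <[g]>, hence lie
   in N, and so would g.  Thus g is a p-element, and g ^+ p is in N.  So every
   nonidentity element of G / N has prime order, and it remains to classify the
   groups with that property.

   In such a group G centralisers are p-groups.  The key to the soluble case is
   that if an abelian p-group A is normalised by Q of prime order
   r <> p and by some y outside Q normalising Q, then A = 1 (a norm argument).
   So a Sylow subgroup is normal of prime index, and centralisers make the
   extension Frobenius.

   A minimal insoluble G of odd order would be simple, with TI Sylow subgroups
   P_p and Frobenius normalisers P_p : q_p.  Inducing the characters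
   Ind 1 - chi from N(P_p), where chi is induced from a linear character,
   produces a set Y_p of exceptional irreducible characters of G.  The parity
   of the inner product of real characters of a group of odd order makes each
   irreducible character of one family occur in the virtual characters of the
   other, for every pair of primes, in one of the two directions; counting this
   relation by norms on one side, and by the mass of a character over the
   p-elements on the other side, gives a contradiction.

   In even order the Sylow 2-subgroups P are elementary abelian and TI.  An
   averaging argument shows that each coset of B = N(P) outside B contains
   exactly |P| - 1 involutions.  This yields |P| = q + 1 with q prime and
   |G| = q (q + 1) (q + 2).  Counting pairs (x, v) with v an involution
   inverting x forces q = 3, and G acts faithfully on the 5 cosets of B. *)

(** * Finite groups whose nontrivial elements have prime order *)

Definition prime_orders (gT : finGroupType) (G : {set gT}) :=
  {in G^#, forall x, prime #[x]}.

Section PrimeOrders.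

Variable gT : finGroupType.
Implicit Types (G H A Q : {group gT}) (p : nat).

Lemma prime_ordersS (G H : {set gT}) :
  H \subset G -> prime_orders G -> prime_orders H.
Proof. by move=> sHG poG x /setD1P[ntx Hx]; rewrite poG // !inE ntx (subsetP sHG). Qed.

Lemma prime_orders_quotient G N : prime_orders G -> prime_orders (G / N).
Proof.
move=> poG xN /setD1P[ntxN /morphimP[x nNx Gx def_xN]].
have ntx: x != 1 by apply: contraNneq ntxN => x1; rewrite def_xN x1 morph1.
have px: prime #[x] by rewrite poG // !inE ntx.
have := morph_order (coset_morphism N) nNx; rewrite -def_xN.
by move/(primeP px).2/orP=> [|/eqP->//]; rewrite order_eq1 (negPf ntxN).
Qed.

Lemma prime_orders_pelt G p x :
  prime_orders G -> x \in G^# -> p.-elt x -> #[x] = p.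
Proof.
move=> poG Gx; have px := poG x Gx; rewrite /p_elt pnatE // => /eqP //.
Qed.

Lemma prime_orders_expn G p x :
  prime_orders G -> x \in G -> p.-elt x -> x ^+ p = 1.
Proof.
move=> poG Gx px; have [-> | ntx] := eqVneq x 1; first by rewrite expg1n.
by rewrite -{1}(prime_orders_pelt poG _ px) ?expg_order // !inE ntx.
Qed.

(** Distinct prime orders would be coprime, and [x * y] would have their product as its order. *)
Lemma prime_orders_commute G x y :
  prime_orders G -> x \in G^# -> y \in G^# -> commute x y -> #[x] = #[y].
Proof.
move=> poG Gx Gy cxy; have [px py] := (poG x Gx, poG y Gy).
have [//|neq_xy] := eqVneq #[x] #[y].
have co_xy: coprime #[x] #[y] by rewrite prime_coprime // dvdn_prime2.
have oxy: #[x * y] = (#[x] * #[y])%N by apply: orderM.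
have Gxy: x * y \in G^#.
  have [[_ Gx1] [_ Gy1]] := (setD1P Gx, setD1P Gy).
  rewrite !inE groupM // andbT -order_eq1 oxy muln_eq1.
  by rewrite negb_and (gtn_eqF (prime_gt1 px)).
have := poG _ Gxy; rewrite oxy => /primeP[_ /(_ #[x])].
rewrite dvdn_mulr // (gtn_eqF (prime_gt1 px)) /= => /(_ isT)/eqP/esym.
move/eqP; rewrite -{2}[#[x]]muln1 eqn_pmul2l ?order_gt0 //.
by rewrite (gtn_eqF (prime_gt1 py)).
Qed.

Lemma prime_orders_cent1 G x :
  prime_orders G -> x \in G^# -> #[x].-group 'C_G[x].
Proof.
move=> poG Gx; apply/pgroupP => r r_pr /(Cauchy r_pr)[y /setIP[Gy /cent1P cxy] oy].
rewrite inE /= (@prime_orders_commute G x y) ?oy //.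
by rewrite !inE Gy andbT -order_eq1 oy gtn_eqF ?prime_gt1.
Qed.

Lemma sum_cycle (V : nmodType) (f : gT -> V) z :
  (\sum_(w in <[z]>) f w = \sum_(j < #[z]) f (z ^+ j)%g)%R.
Proof.
have ->: <[z]> = [set z ^+ (j : 'I_#[z]) | j in 'I_#[z]]%g.
  apply/setP=> w; apply/idP/imsetP=> [/cyclePmin[j ltj ->] | [j _ ->]].
    by exists (Ordinal ltj).
  exact: mem_cycle.
rewrite big_imset //= => i j _ _ /eqP.
by rewrite eq_expg_mod_order !modn_small // => /eqP/val_inj.
Qed.

(** If [z] has order [p], the norm is [(u * z^-1) ^+ p], computed in a [p]-group whose elements
    satisfy [x ^+ p = 1]. Otherwise [z] centralises the norm, while it commutes with no nontrivial
    element of the [p]-group [A]. *)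
Lemma cycle_norm_eq0 G p A z (abA : abelian A) (u : fmod_of abA) :
    prime_orders G -> A \subset G -> z \in G^# -> p.-group A -> z \in 'N(A) ->
  (\sum_(j < #[z]) actr u (z ^+ j)%g = 0)%R.
Proof.
move=> poG sAG Gz pA nAz; have prz := poG z Gz; have [ntz Gz1] := setD1P Gz.
have Au := fmodP u; set S := (\sum_(j < _) _)%R; apply: val_inj; change (fmval S = 1).
have [oz | neq_zp] := eqVneq #[z] p.
  have norm k: fmval (\sum_(j < k) actr u (z ^+ j)%g)%R = (fmval u * z^-1) ^+ k * z ^+ k.
    elim: k => [|k IHk]; first by rewrite big_ord0 mulg1.
    rewrite big_ord_recr; pose ak := actr u (z ^+ k).
    transitivity (fmval (\sum_(j < k) actr u (z ^+ j)%g)%R * fmval ak); first by [].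
    have ->: fmval ak = fmval u ^ (z ^+ k) by apply: fmvalJ; rewrite groupX.
    by rewrite IHk -mulgA -conjgC expgSr [in z ^+ k.+1]expgS -!mulgA mulKg.
  rewrite norm expg_order mulg1.
  have pAz: p.-group (A <*> <[z]>).
    rewrite norm_joinEr ?cycle_subG // pgroupM pA /pgroup -orderE.
    by apply/andP; split=> //; rewrite -{1}oz pnat_id.
  have Au': fmval u \in A := Au.
  have AzE: fmval u * z^-1 \in A <*> <[z]>.
    by rewrite groupM ?groupV ?mem_gen // inE ?Au' ?cycle_id ?orbT.
  rewrite oz; apply: prime_orders_expn poG _ (mem_p_elt pAz AzE).
  by rewrite groupM ?groupV // (subsetP sAG).
apply/eqP; apply: contraNT neq_zp => ntS.
have GS: fmval S \in G^# by rewrite !inE ntS (subsetP sAG) ?fmodP.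
have fixS: (actr S z = S)%R.
  rewrite /S (big_morph _ (actAr z) (act0r _ z)).
  transitivity (\sum_(j < #[z]) actr u (z ^+ j.+1)%g)%R.
    by apply: eq_bigr => j _; rewrite expgSr actrM ?groupX.
  case: #[z] (expg_order z) => [|r] zr1; first by rewrite !big_ord0.
  by rewrite big_ord_recr big_ord_recl /= zr1 expg0 addrC.
have cSz: commute (fmval S) z.
  by apply/commgP/conjg_fixP; rewrite -fmvalJ ?fixS.
have := prime_orders_commute poG GS Gz cSz; rewrite (@prime_orders_pelt G p) // => [->|] //.
exact: mem_p_elt pA (fmodP _).
Qed.

(* Writing A additively, the norms over Q and over each <[z]> with z in the
   coset Q :* y vanish.  Summing the latter over the coset and regrouping by
   exponents leaves #|Q| times the identity, since z |-> z ^+ j maps Q :* y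
   onto Q :* y ^+ j when 0 < j < #[y]. *)
Lemma prime_orders_noaction G p A Q y :
    prime_orders G -> A \subset G -> Q \subset G -> y \in G ->
    abelian A -> p.-group A -> prime #|Q| -> #|Q| != p ->
    Q \subset 'N(A) -> y \in 'N(A) -> y \in 'N(Q) -> y \notin Q ->
  A :=: 1.
Proof.
move=> poG sAG sQG Gy abA pA prQ neq_qp nAQ nAy nQy notQy.
have nty: y != 1 by apply: contraNneq notQy => ->.
have pry: prime #[y] by rewrite poG // !inE nty.
have normQ (u : fmod_of abA): (\sum_(w in Q) actr u w = 0)%R.
  have [x defQ] := cyclicP (prime_cyclic prQ).
  have Gx: x \in G^#.
    by rewrite !inE -cycle_eq1 -cycle_subG -defQ sQG -cardG_gt1 prime_gt1.
  rewrite defQ sum_cycle; apply: cycle_norm_eq0 poG sAG Gx pA _.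
  by rewrite -cycle_subG -defQ.
have Qy z: z \in Q :* y -> [/\ z \in G^#, z \in 'N(A) & #[z] = #[y]].
  move=> Qyz; have [x Qx def_z] := rcosetP Qyz.
  have notQz: z \notin Q by rewrite def_z groupMl.
  have ntz: z != 1 by apply: contraNneq notQz => ->.
  have Gz: z \in G^# by rewrite !inE ntz def_z groupM // (subsetP sQG).
  split=> //; first by rewrite def_z groupM // (subsetP nAQ).
  (* If the prime orders differed, [z] would be a power of [z ^+ #[y]], which lies in [Q] because
     [z] and [y] agree modulo [Q]. *)
  have prz := poG z Gz; apply/eqP; apply: contraR notQz => neq_zy.
  have co_zy: coprime #|<[z]>| #[y] by rewrite -orderE prime_coprime // dvdn_prime2.
  rewrite -(expgK co_zy (cycle_id z)) groupX // def_z.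
  have Qxy: coset Q x * coset Q y = coset Q (x * y).
    by rewrite morphM // (subsetP (normG Q)).
  rewrite coset_idr ?groupX ?groupM // ?(subsetP (normG Q)) //.
  rewrite morphX ?groupM // ?(subsetP (normG Q)) //= -Qxy coset_id // mul1g.
  by rewrite -morphX //= expg_order morph1.
apply/trivgP/subsetP=> v Av; rewrite inE; pose u : fmod_of abA := fmod abA v.
have /(congr1 fmval): (u *+ #|Q| = 0)%R.
  have: (\sum_(z in Q :* y) \sum_(j < #[y]) actr u (z ^+ j)%g = 0)%R.
    rewrite big1 // => z /Qy[Gz nAz <-].
    exact: cycle_norm_eq0 poG sAG Gz pA nAz.
  rewrite exchange_big /=; case oy: #[y] => [|r]; first by rewrite oy in pry.
  rewrite big_ord_recl /= [X in (_ + X)%R]big1 => [|j _].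
    by rewrite addr0 (eq_bigr (fun=> u)) ?sumr_const ?card_rcoset // => i _; rewrite expg0 actr1.
  have co_j: coprime #[y] j.+1.
    by rewrite prime_coprime // gtnNdvd // oy ltnS.
  have imQ: [set z ^+ j.+1 | z in Q :* y] = Q :* y ^+ j.+1.
    apply/eqP; rewrite eqEcard; apply/andP; split.
      apply/subsetP=> _ /imsetP[_ /rcosetP[x Qx ->] ->].
      rewrite mem_rcoset; apply: coset_idr.
        by rewrite !in_group ?groupM ?groupX ?groupV ?groupX // (subsetP (normG Q)).
      have nQx := subsetP (normG Q) x Qx.
      rewrite morphM ?groupV ?groupX ?groupM //= morphV ?groupX //= !morphX ?groupM //=.
      by rewrite morphM //= coset_id // mul1g mulgV.
    rewrite card_rcoset card_in_imset ?card_rcoset // => z1 z2 /Qy[_ _ o1] /Qy[_ _ o2] eq_z.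
    have c1: coprime #|<[z1]>| j.+1 by rewrite -orderE o1.
    have c2: coprime #|<[z2]>| j.+1 by rewrite -orderE o2.
    rewrite -(expgK c1 (cycle_id z1)) -(expgK c2 (cycle_id z2)) /= eq_z.
    by rewrite /expg_invn -!orderE o1 o2.
  rewrite -(big_imset (fun z => actr u z)) /=; last first.
    move=> z1 z2 /Qy[_ _ o1] /Qy[_ _ o2] eq_z.
    have c1: coprime #|<[z1]>| j.+1 by rewrite -orderE o1.
    have c2: coprime #|<[z2]>| j.+1 by rewrite -orderE o2.
    rewrite -(expgK c1 (cycle_id z1)) -(expgK c2 (cycle_id z2)) /= eq_z.
    by rewrite /expg_invn -!orderE o1 o2.
  rewrite imQ -rcosetE /rcoset big_imset /=; last exact: in2W (mulIg _).
  rewrite (eq_bigr (fun w => actr (actr u w) (y ^+ j.+1))) => [|w Qw].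
    by rewrite -(big_morph _ (actAr _) (act0r _ _)) normQ act0r.
  by rewrite actrM ?groupX // (subsetP nAQ).
rewrite fmvalZ fmodK // => vq1.
have co_q: coprime #|A| #|Q|.
  by rewrite (pnat_coprime pA) // pnatE // inE.
by rewrite -(expgK co_q Av) /= vq1 expg1n.
Qed.

End PrimeOrders.

(** * Soluble groups: a normal Sylow subgroup of index 1 or prime *)

Section SolvablePrimeOrders.

Variable gT : finGroupType.
Implicit Types (G H A Q R S : {group gT}) (p q r : nat).

(** Take [x] of order [r] in the centre of [R]. An element of [R] outside [<[x]>] normalises
    [<[x]>], and [prime_orders_noaction] would make [A] trivial. *)
Lemma prime_orders_card_regular G p r A R :
    prime_orders G -> A <| G -> A :!=: 1 -> p.-abelem A ->
    R \subset G -> r.-group R -> r != p -> R :!=: 1 -> #|R| = r.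
Proof.
move=> poG nsAG ntA abelA sRG rR neq_rp ntR; have [sAG nAG] := andP nsAG.
have [r_pr r_dv_R _] := pgroup_pdiv rR ntR.
have ntZ: 'Z(R) != 1 by rewrite center_nil_eq1 ?(pgroup_nil rR).
have [_ r_dv_Z _] := pgroup_pdiv (pgroupS (center_sub R) rR) ntZ.
have [x /setIP[Rx cRx] ox] := Cauchy r_pr r_dv_Z.
have [sRx | /subsetPn[y Ry notXy]] := boolP (R \subset <[x]>).
  have ->: R :=: <[x]> by apply/eqP; rewrite eqEsubset sRx cycle_subG Rx.
  by [].
case/eqP: ntA; have [pA abA _] := and3P abelA.
apply: (@prime_orders_noaction _ G p A <[x]>%G y) => //=.
- by rewrite cycle_subG (subsetP sRG).
- exact: (subsetP sRG).
- by rewrite -orderE ox.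
- by rewrite -orderE ox.
- by rewrite cycle_subG (subsetP (subset_trans sRG nAG)).
- by rewrite (subsetP (subset_trans sRG nAG)).
by apply: (subsetP (cent_sub _)); rewrite cent_cycle cent1C; apply/cent1P/(centP cRx).
Qed.

(** Let [V] be the [p]-core, for a minimal normal [p]-subgroup [A], and [W / V] minimal normal in
    [G / V]. This is an [r]-group with [r != p], and a Sylow [r]-subgroup [Q] of [W] has order [r].
    By [prime_orders_noaction], [Q] is self-normalising, so the Frattini argument gives [G = W]. *)
Lemma solvable_prime_orders G :
    solvable G -> prime_orders G ->
  exists p S, [/\ prime p, p.-Sylow(G) S, S <| G & S :=: G \/ prime #|G : S|].
Proof.
move=> solG poG; have [G1 | ntG] := eqVneq (gval G) 1.
  have G2: 2.-group G by rewrite /pgroup G1 cards1.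
  by exists 2, G; split; [|by rewrite pHallE subxx /= part_pnat_id | exact: normal_refl | left].
have [A minA sAG] := minnormal_exists ntG (normG G).
have [nAG ntA /is_abelemP[p p_pr abelA]] := minnormal_solvable minA sAG solG.
have [pA abA _] := and3P abelA; have nsAG: A <| G by apply/andP.
set V := 'O_p(G)%G; have nsVG: V <| G := pcore_normal p G.
have [sVG nVG] := andP nsVG.
have [defV | ltVG] := eqVneq (gval V) G.
  have pG: p.-group G by rewrite -defV pcore_pgroup.
  by exists p, G; split; [|by rewrite pHallE subxx /= part_pnat_id | exact: normal_refl | left].
have ntGV: G / V != 1 by rewrite -subG1 quotient_sub1 //; apply: contraNN ltVG => ?; rewrite eqEsubset sVG.
have [Wb minWb sWbG] := minnormal_exists ntGV (normG (G / V)).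
have [nWbG ntWb /is_abelemP[r r_pr abelWb]] :=
  minnormal_solvable minWb sWbG (quotient_sol _ solG).
have nsWbG: Wb <| G / V by apply/andP.
have neq_rp: r != p.
  apply: contraNneq ntWb => def_r; rewrite -subG1 -(trivg_pcore_quotient p G).
  by rewrite pcore_max // -def_r abelem_pgroup.
have [W def_Wb sVW nsWG] := inv_quotientN nsVG nsWbG; have [sWG nWG] := andP nsWG.
have [Q sylQ] := Sylow_exists r W; have [sQW rQ _] := and3P sylQ.
have sQG := subset_trans sQW sWG.
have r_dv_W: r %| #|W|.
  apply: dvdn_trans (dvdn_quotient W V).
  by rewrite -def_Wb; case: (pgroup_pdiv (abelem_pgroup abelWb) ntWb).
have ntQ: Q :!=: 1.
  rewrite -cardG_gt1 (card_Hall sylQ) p_part_gt1 mem_primes r_pr cardG_gt0 //.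
have oQ: #|Q| = r by exact: prime_orders_card_regular poG nsAG ntA abelA sQG rQ neq_rp ntQ.
have sNQ: 'N_G(Q) \subset Q.
  apply/subsetP=> y /setIP[Gy nQy]; apply: contraR ntA => notQy; apply/eqP.
  apply: (@prime_orders_noaction _ G p A Q y) => //; rewrite ?oQ //.
    by rewrite (subset_trans sQG) // normal_norm.
  by rewrite (subsetP (normal_norm nsAG)).
have defG: G :=: W.
  apply/eqP; rewrite eqEsubset sWG andbT -(Frattini_arg nsWG sylQ).
  by rewrite mul_subG // (subset_trans sNQ).
have rGV: r.-group (G / V) by rewrite {1}defG -def_Wb (abelem_pgroup abelWb).
have oGV: #|G : V| = #|G / V| by rewrite card_quotient.
have p'GV: p^'.-nat #|G : V|.
  by rewrite oGV; apply: sub_in_pnat rGV => t _; rewrite !inE => /eqP->.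
exists p, V; split=> //; first by
  rewrite pHallE sVG /= -(part_pnat_id (pcore_pgroup p G)) -(Lagrange sVG) partnM // (part_p'nat p'GV) muln1.
right; suffices ->: #|G : V| = r by [].
rewrite -oQ (card_Hall sylQ) -defG -(Lagrange sVG) partnM // part_p'nat ?mul1n.
  by rewrite part_pnat_id // oGV.
by apply: sub_in_pnat (pcore_pgroup p G) => t _; rewrite !inE => /eqP->; rewrite eq_sym.
Qed.

End SolvablePrimeOrders.

(** * Counting in groups of odd order *)

Section OddCharacters.

Local Open Scope ring_scope.

(** [Q] selects from each pair [{i, s i}] the member enumerated first. *)
Lemma sum_involution (V : nmodType) (I : finType) (P : pred I) (f : I -> V) (s : I -> I) :
    involutive s -> (forall i, P i -> [/\ P (s i), s i != i & f (s i) = f i]) ->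
  exists Q : pred I, \sum_(i | P i) f i = (\sum_(i | P i && Q i) f i) *+ 2.
Proof.
move=> sK sP; pose Q i := (enum_rank i < enum_rank (s i))%N; exists Q.
rewrite (bigID Q) mulr2n /=; congr (_ + _); rewrite (reindex_inj (inv_inj sK)) /=.
have PsE i: P (s i) = P i by apply/idP/idP=> [/sP[]|/sP[]//]; rewrite sK.
apply: eq_big => [i | i /andP[+ _]]; rewrite PsE; last by case/sP.
case Pi: (P i) => //=; have [_ s'i _] := sP i Pi.
by rewrite /Q sK -leqNgt leq_eqVlt (inj_eq val_inj) (inj_eq enum_rank_inj) eq_sym (negPf s'i).
Qed.

Variables (gT : finGroupType) (G : {group gT}).
Implicit Types (A B : {set gT}) (phi psi : 'CF(G)) (a b : Iirr G).

Lemma cfdot_disjoint A B phi psi :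
  [disjoint A & B] -> phi \in 'CF(G, A) -> psi \in 'CF(G, B) -> '[phi, psi] = 0.
Proof.
rewrite -setI_eq0 => /eqP tiAB Aphi Bpsi.
by rewrite (cfdotElr Aphi Bpsi) tiAB big_set0 mulr0.
Qed.

Hypothesis oddG : odd #|G|.

(** Burnside's argument: for a real ['chi_a], orthogonality to 1, with the values at [x] and [x^-1]
    paired, makes the degree twice an algebraic integer, hence even; but the degree divides
    [#|G|]. *)
Lemma odd_conjC_Iirr_neq a : a != 0 -> conjC_Iirr a != a.
Proof.
apply: contraNneq => /(congr1 (tnth (irr G))); rewrite conjC_IirrE => real_a.
apply: contraLR oddG => nz_a.
have: '['chi_a, 1] == 0 by rewrite -irr0 cfdot_irr (negPf nz_a).
rewrite cfdotE mulf_eq0 invr_eq0 pnatr_eq0 -[_ == 0%N]negbK -lt0n cardG_gt0 /=.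
rewrite (eq_bigr 'chi_a) => [|x Gx]; last by rewrite cfun1E Gx rmorph1 mulr1.
rewrite (bigD1 1%g) //=; have [Q ->] : exists Q : pred gT,
  \sum_(x in G | x != 1%g) 'chi_a x = (\sum_(x | (x \in G) && (x != 1%g) && Q x) 'chi_a x) *+ 2.
- apply: (sum_involution (s := invg)) => [|x /andP[Gx ntx]]; first exact: invgK.
  rewrite groupV Gx invg_eq1 ntx; split=> //; last by rewrite irr_inv -{2}real_a cfunE.
  apply: contraTneq oddG => xVx; rewrite -dvdn2.
  have <-: #[x] = 2%N by apply: nt_prime_order; rewrite // expgS expg1 -{1}xVx mulVg.
  exact: order_dvdG.
set z := \sum_(x | _) _; rewrite addr_eq0 => /eqP chi1.
have Az: - z \in Aint by rewrite rpredN; apply: rpred_sum => x _; apply: Aint_irr.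
have z2: 'chi_a 1%g = - z * 2%:R by rewrite chi1 -mulNrn mulr_natr.
have Zz: - z \in Num.int.
  have nz2: 2%:R != 0 :> algC by rewrite pnatr_eq0.
  rewrite Cint_rat_Aint // -[- z](mulfK nz2) -z2 rpred_div ?rpred_nat //.
  by have /natrP[n ->] := Cnat_irr1 a; rewrite rpred_nat.
rewrite -dvdn2 -dvdC_nat; apply: dvdC_trans (dvd_irr1_cardG a).
by apply/dvdCP; exists (- z).
Qed.

(** The nonprincipal constituents fall into conjugate pairs with equal contributions, so only the
    principal one counts modulo 2. *)
Lemma real_cfdot_parity phi psi :
    phi \in 'Z[irr G] -> psi \in 'Z[irr G] -> (phi^*)%CF = phi -> (psi^*)%CF = psi ->
  (2%:R %| '[phi, psi] - '[phi, 1] * '[psi, 1])%C.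
Proof.
move=> Zphi Zpsi real_phi real_psi.
rewrite cfdot_sum_irr (bigD1 0) //= irr0 [X in (_ * X) + _]conj_intr ?Cint_cfdot_vchar ?rpred1 //.
rewrite addrC addKr.
have [Q ->] : exists Q : pred (Iirr G),
    \sum_(i | i != 0) '[phi, 'chi_i] * '[psi, 'chi_i]^*
       = (\sum_(i | (i != 0) && Q i) '[phi, 'chi_i] * '[psi, 'chi_i]^*) *+ 2.
  apply: (sum_involution (s := @conjC_Iirr _ G)) => [|i nz_i]; first exact: conjC_IirrK.
  split; [by rewrite conjC_Iirr_eq0 | exact: odd_conjC_Iirr_neq |].
  rewrite conjC_IirrE -{1}real_phi -{1}real_psi !cfdot_conjC.
  by rewrite !(conj_intr (Cint_cfdot_vchar_irr _ _)).
rewrite -mulr_natr dvdC_mull ?rpred_sum // => i _.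
by rewrite rpredM // ?(conj_intr (Cint_cfdot_vchar_irr _ _)) ?Cint_cfdot_vchar_irr.
Qed.

End OddCharacters.

(** * Families of exceptional characters *)

Section Exceptional.

Local Open Scope ring_scope.

Variables (gT : finGroupType) (G : {group gT}).
Implicit Types (A B : {set gT}) (phi psi : 'CF(G)) (a b c : Iirr G) (q r : nat).

(* A family of virtual characters al a supported in A, indexed by a set Y of
   irreducible characters that are paired with each other by complex
   conjugation.  For A the conjugates of P^# with P a Sylow p-subgroup, al a is
   induced from the character 'Ind 1 - chi of 'N_G(P), chi being induced from a
   linear character of P, and q = #|'N_G(P) : P|. *)
Record exceptional A q (Y : {set Iirr G}) (al : Iirr G -> 'CF(G)) : Prop := Exceptional {
  exc_vchar : {in Y, forall a, al a \in 'Z[irr G, A]};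
  exc_dot : {in Y &, forall a b, '[al a, al b] = (q + (a == b))%:R};
  exc_cfun1 : {in Y, forall a, '[al a, 1] = 1};
  exc_conjY : {in Y, forall a, conjC_Iirr a \in Y};
  exc_neq : {in Y, forall a, conjC_Iirr a != a};
  exc_conj : {in Y, forall a, al (conjC_Iirr a) = ((al a)^*)%CF};
  exc_diff : {in Y, forall a, al (conjC_Iirr a) - al a = 'chi_a - 'chi_(conjC_Iirr a)}
}.

Section OneFamily.

Variables (A : {set gT}) (q : nat) (Y : {set Iirr G}) (al : Iirr G -> 'CF(G)).
Hypothesis excA : exceptional A q Y al.

Lemma exc_irr a b : a \in Y -> '[al a, 'chi_b] \in Num.int.
Proof. by move/(exc_vchar excA)/zcharW => Zal; rewrite Cint_cfdot_vchar_irr. Qed.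

Lemma exc_dot_conj a b : a \in Y -> '[al (conjC_Iirr a), 'chi_(conjC_Iirr b)] = '[al a, 'chi_b].
Proof.
by move=> Ya; rewrite (exc_conj excA) // conjC_IirrE cfdot_conjC conj_intr ?exc_irr.
Qed.

Lemma exc_diff_norm2 a b : a \in Y -> b \in Y -> a != b -> 1%g \notin A ->
  exists i, exists2 j, j != i & al a - al b = 'chi_i - 'chi_j.
Proof.
move=> Ya Yb neq_ab notA1; apply: vchar_norm2.
  have [Za Zb] := (exc_vchar excA Ya, exc_vchar excA Yb).
  rewrite zcharD1E rpredB ?(zcharW Za) ?(zcharW Zb) //= !cfunE.
  by rewrite (cfun_on0 (zchar_on Za)) // (cfun_on0 (zchar_on Zb)) // subrr.
rewrite cfnormB !(exc_dot excA) // !eqxx (negPf neq_ab) conjC_nat addn0 addn1.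
by rewrite -natr1; ring.
Qed.

(** By [exc_diff], the multiplicities of ['chi_a] in [al (conjC_Iirr a)] and in [al a] differ by 1,
    and the former is that of the conjugate of ['chi_a] in [al a]. *)
Lemma exc_own a : a \in Y -> exists2 b, b \in Y & '[al a, 'chi_b] != 0.
Proof.
move=> Ya; have [z0 | nz] := eqVneq '[al a, 'chi_a] 0; last by exists a.
exists (conjC_Iirr a); first exact: exc_conjY excA a Ya.
have := congr1 (cfdotr 'chi_a) (exc_diff excA Ya).
rewrite /cfdotr /= !cfdotBl z0 subr0 !cfdot_irr eqxx (negPf (exc_neq excA Ya)) subr0.
rewrite -[a in X in '[_, 'chi_X]]conjC_IirrK exc_dot_conj // => ->.
exact: oner_neq0.
Qed.

Lemma exc_half_bound a : a \in Y -> `|'['chi_a, al (conjC_Iirr a) - al a]| ^+ 2 = 1.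
Proof.
move=> Ya; rewrite (exc_diff excA) // cfdotBr !cfdot_irr eqxx eq_sym (negPf (exc_neq excA Ya)).
by rewrite subr0 normr1 expr1n.
Qed.

(* For b outside {a, a^*}, either xi_a or xi_a^* has inner product +-3 with
   al b + al b^* + al a^* - 3 al a, a vector of norm 12. *)
Lemma exc_three a : a \in Y -> (2 < #|Y|)%N -> 1%g \notin A ->
  exists2 c, c \in Y & exists v, [/\ v \in 'CF(G, A), '[v] = 12%:R & `|'['chi_c, v]| ^+ 2 = 9%:R].
Proof.
move=> Ya gtY2 notA1; set a' := conjC_Iirr a; have Ya': a' \in Y := exc_conjY excA Ya.
have neq_a'a: a' != a := exc_neq excA Ya.
have [b Yb neq_b]: exists2 b, b \in Y & b \notin [set a; a'].
  by apply/subsetPn; apply: contraL gtY2 => /subset_leq_card;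
  rewrite cards2 -leqNgt => /leq_trans-> //; case: (_ != _).
have{neq_b} [neq_ba neq_ba']: b != a /\ b != a' by apply/norP; rewrite !inE in neq_b.
set b' := conjC_Iirr b; have Yb': b' \in Y := exc_conjY excA Yb.
have neq_b'b: b' != b := exc_neq excA Yb.
have neq_b'a': b' != a' by rewrite (inj_eq (inv_inj (@conjC_IirrK _ G))).
have neq_b'a: b' != a by rewrite -[a](@conjC_IirrK _ G) (inj_eq (inv_inj (@conjC_IirrK _ G))).
(* The coefficients sum to zero, so [q] cancels in the norm and leaves [1 + 1 + 1 + 9]. *)
pose v := al b + al b' + al a' - al a *+ 3.
have Av: v \in 'CF(G, A).
  by rewrite rpredB ?rpredD ?rpredMn // (zchar_on (exc_vchar excA _)).
have nd u w: u \in Y -> w \in Y -> u != w -> '[al u, al w] = q%:R.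
  by move=> Yu Yw neq_uw; rewrite (exc_dot excA) // (negPf neq_uw) addn0.
have nn u: u \in Y -> '[al u] = q%:R + 1.
  by move=> Yu; rewrite (exc_dot excA) // eqxx natrD.
have nv: '[v] = 12%:R.
  rewrite /v !(cfdotDl, cfdotDr, cfdotNl, cfdotNr, cfdotMnl, cfdotMnr) !nn //.
  by rewrite !nd //; try ring; rewrite eq_sym.
have /(congr1 (cfdotr 'chi_a)) Da := exc_diff excA Ya.
rewrite /cfdotr /= !cfdotBl !cfdot_irr eqxx (negPf neq_a'a) subr0 in Da.
have {Da}Da: '[al a', 'chi_a] = '[al a, 'chi_a] + 1.
  by move/eqP: Da; rewrite subr_eq addrC => /eqP.
have eq_e: '[al b, 'chi_a] = '[al b', 'chi_a].
  rewrite -[in RHS](@conjC_IirrK _ G a) exc_dot_conj //; apply/eqP.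
  by rewrite -subr_eq0 -cfdotBr -(exc_diff excA) // cfdotBr !nd ?subrr.
have dot_a c: '[al a', 'chi_(conjC_Iirr c)] = '[al a, 'chi_c] by apply: exc_dot_conj.
have dot_b c: '[al b', 'chi_(conjC_Iirr c)] = '[al b, 'chi_c] by apply: exc_dot_conj.
have dot_b' c: '[al b, 'chi_(conjC_Iirr c)] = '[al b', 'chi_c].
  by rewrite -dot_b conjC_IirrK.
have dot_a' c: '[al a, 'chi_(conjC_Iirr c)] = '[al a', 'chi_c].
  by rewrite -dot_a conjC_IirrK.
have [i [j neq_ji Dab]] := exc_diff_norm2 Yb Ya neq_ba notA1.
have Eab: '[al b, 'chi_a] - '[al a, 'chi_a] = (i == a)%:R - (j == a)%:R.
  by rewrite -cfdotBl Dab cfdotBl !cfdot_irr.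
have Eab': '[al b, 'chi_a] - ('[al a, 'chi_a] + 1) = (i == a')%:R - (j == a')%:R.
  have <-: '[al b, 'chi_a'] = '[al b, 'chi_a] by rewrite dot_b'.
  have <-: '[al a, 'chi_a'] = '[al a, 'chi_a] + 1 by rewrite dot_a' Da.
  by rewrite -cfdotBl Dab cfdotBl !cfdot_irr.
have norm_sym c z: '[v, 'chi_c] = z -> z = 3%:R \/ z = - 3%:R -> `|'['chi_c, v]| ^+ 2 = 9%:R.
  by move=> Dz z3; rewrite cfdotC norm_conjC Dz; case: z3 => ->; rewrite ?normrN normr_nat -natrX.
(* With [e] and [d] the multiplicities of ['chi_a] in [al b] and [al a], the two products are
   [2 (e - d) + 1] and [2 (e - d) - 3]. Here [e - d] is 1, 0 or -1: the value 1 makes the first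
   product 3, the value 0 makes the second -3, and -1 contradicts [Eab']. *)
have Dva: '[v, 'chi_a] = 2%:R * ('[al b, 'chi_a] - '[al a, 'chi_a]) + 1.
  rewrite /v cfdotBl cfdotMnl !cfdotDl -eq_e.
  by rewrite Da; ring.
have Dva': '[v, 'chi_a'] = 2%:R * ('[al b, 'chi_a] - '[al a, 'chi_a]) - 3%:R.
  rewrite /v cfdotBl cfdotMnl !cfdotDl dot_a dot_a' dot_b dot_b' -eq_e.
  by rewrite Da; ring.
have [ia | neq_ia] := eqVneq i a.
  exists a => //; exists v; split=> //; apply: (norm_sym _ _ Dva); left.
  by rewrite Eab; rewrite ia in neq_ji *; rewrite eqxx (negPf neq_ji) /=; ring.
exists a' => //; exists v; split=> //; apply: (norm_sym _ _ Dva'); right.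
rewrite Eab (negPf neq_ia); have [ja | _] := eqVneq j a; last by ring.
have := Eab'; rewrite opprD addrA Eab ja eqxx (negPf neq_ia) [a == a']eq_sym (negPf neq_a'a).
case: (i == a') => /eqP; rewrite -subr_eq0.
  have ->: 0%:R - true%:R - 1 - (true%:R - false%:R) = - 3%:R :> algC by rewrite /=; ring.
  by rewrite oppr_eq0 pnatr_eq0.
have ->: 0%:R - true%:R - 1 - (false%:R - false%:R) = - 2%:R :> algC by rewrite /=; ring.
by rewrite oppr_eq0 pnatr_eq0.
Qed.

End OneFamily.

End Exceptional.

(** * Mass of a character on a set, and pairs of families with disjoint supports *)

Section Families.

Local Open Scope ring_scope.

Variables (gT : finGroupType) (G : {group gT}).
Implicit Types (A B : {set gT}) (phi psi : 'CF(G)) (a b c : Iirr G) (q r : nat).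

Definition mass A phi := \sum_(x in A) `|phi x| ^+ 2.

(** Cauchy-Schwarz for [psi] and [phi] cut down to [A], which has the same product with [psi] as
    [phi]. *)
Lemma mass_Cauchy A phi psi : A <| G -> psi \in 'CF(G, A) ->
  `|'[phi, psi]| ^+ 2 * #|G|%:R <= mass A phi * '[psi].
Proof.
move=> nsAG Apsi; pose phiA := '1_A * phi.
have AphiA: phiA \in 'CF(G, A).
  by apply/cfun_onP=> x notAx; rewrite cfunE cfuniE // (negPf notAx) mul0r.
have phiAE: {in A, phiA =1 phi} by move=> x Ax; rewrite cfunE cfuniE // Ax mul1r.
have <-: '[phiA, psi] = '[phi, psi].
  by rewrite !(cfdotEr _ Apsi); congr (_ * _); apply: eq_bigr => x Ax; rewrite phiAE.
have ->: mass A phi = '[phiA] * #|G|%:R.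
  rewrite (cfnormE AphiA) mulrC mulVKf ?neq0CG //.
  by apply: eq_bigr => x Ax; rewrite phiAE.
rewrite [leRHS]mulrAC ler_pM2r ?gt0CG //; exact: cfCauchySchwarz.
Qed.

Lemma mass_ge0 A phi : 0 <= mass A phi.
Proof. by apply: sumr_ge0 => x _; rewrite exprn_ge0. Qed.

Section TwoFamilies.

Variables (A B : {set gT}) (q r : nat) (Y Z : {set Iirr G}) (al be : Iirr G -> 'CF(G)).
Hypotheses (excA : exceptional A q Y al) (excB : exceptional B r Z be).
Hypothesis tiAB : [disjoint A & B].

Lemma exc_cfdot_disjoint a b : a \in Y -> b \in Z -> '[al a, be b] = 0.
Proof.
by move=> Ya Zb; rewrite (cfdot_disjoint tiAB) ?(zchar_on (exc_vchar excA _)) ?(zchar_on (exc_vchar excB _)).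
Qed.

(** For a common member [a], [exc_diff] would write ['chi_a - 'chi_(conjC_Iirr a)] in terms of
    either family, so it would be orthogonal to itself. *)
Lemma exc_disjoint : [disjoint Y & Z].
Proof.
rewrite -setI_eq0; apply/eqP/setP=> a; rewrite !inE; apply/negP=> /andP[Ya Za].
have: '['chi_a - 'chi_(conjC_Iirr a), 'chi_a - 'chi_(conjC_Iirr a)] == 0.
  rewrite -{1}(exc_diff excA Ya) -(exc_diff excB Za) cfdotBl !cfdotBr.
  by rewrite !exc_cfdot_disjoint ?subrr // ?(exc_conjY excA) ?(exc_conjY excB).
rewrite cfnorm_eq0 subr_eq0 (inj_eq irr_inj) eq_sym; exact/negP/(exc_neq excA).
Qed.

(* al a + 'chi_a and be b + 'chi_b are real, with inner product
   ['chi_a, be b] + [al a, 'chi_b], which is thus odd. *)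
Lemma exc_parity a b : odd #|G| -> a \in Y -> b \in Z ->
  '[al a, 'chi_b] = 0 -> '[be b, 'chi_a] != 0.
Proof.
move=> oddG Ya Zb ab0; apply/eqP=> ba0.
have neq_ab: a != b by apply: contraTneq Ya => ->; rewrite (disjointFl exc_disjoint).
have realZ C t (X : {set Iirr G}) (ga : Iirr G -> 'CF(G)) c :
    exceptional C t X ga -> c \in X ->
  [/\ ga c + 'chi_c \in 'Z[irr G], ((ga c + 'chi_c)^*)%CF = ga c + 'chi_c & '[ga c + 'chi_c, 1] = 1].
- move=> excC Xc; split.
  + by rewrite rpredD ?irr_vchar // (zcharW (exc_vchar excC Xc)).
  + rewrite rmorphD /= -(exc_conj excC) // -conjC_IirrE.
    by apply/eqP; rewrite -subr_eq0 opprD addrACA (exc_diff excC) // addrA subrK subrr.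
  rewrite cfdotDl (exc_cfun1 excC) // -irr0 cfdot_irr.
  suffices /negPf->: c != 0 by rewrite addr0.
  by apply: contraNneq (exc_neq excC Xc) => ->; rewrite conjC_Iirr0.
have [[ZA realA A1] [ZB realB B1]] := (realZ _ _ _ _ _ excA Ya, realZ _ _ _ _ _ excB Zb).
have := real_cfdot_parity oddG ZA ZB realA realB; rewrite A1 B1.
rewrite !cfdotDl !cfdotDr exc_cfdot_disjoint // ab0 cfdot_irr (negPf neq_ab).
rewrite cfdotC ba0 conjC0 !addr0 sub0r mulr1 rpredN.
by move=> dv21; have := dvdC_nat 2 1; rewrite [X in X = _]dv21.
Qed.

(** For [b != b'], [be b - be b'] is a difference of two irreducible characters, orthogonal to
    ['chi_a - 'chi_(conjC_Iirr a)]. If ['chi_a] were one of the two, this product could not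
    vanish. *)
Lemma exc_const a b b' : 1%g \notin B -> a \in Y -> b \in Z -> b' \in Z ->
  '[be b, 'chi_a] = '[be b', 'chi_a].
Proof.
move=> notB1 Ya Zb Zb'; have [-> // | neq_bb'] := eqVneq b b'.
have [i [j neq_ji Dbb']] := exc_diff_norm2 excB Zb Zb' neq_bb' notB1.
have: '[be b - be b', 'chi_a - 'chi_(conjC_Iirr a)] = 0.
  rewrite -(exc_diff excA Ya) cfdotBl !cfdotBr ![ '[be _, al _]]cfdotC.
  by rewrite !exc_cfdot_disjoint ?(exc_conjY excA) // !conjC0 !subrr.
rewrite cfdotBr => /eqP; rewrite subr_eq0 Dbb' !cfdotBl !cfdot_irr.
move=> eq_ij; apply/eqP; rewrite -subr_eq0 -cfdotBl Dbb' cfdotBl !cfdot_irr.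
have neq_a := exc_neq excA Ya; set a' := conjC_Iirr a in eq_ij neq_a.
have [Dia | ] := eqVneq i a.
  move: eq_ij; rewrite Dia eqxx [a == a']eq_sym (negPf neq_a).
  rewrite -Dia (negPf neq_ji) subr0 sub0r -subr_eq0 opprK.
  by case: (j == a'); rewrite -natrD pnatr_eq0.
have [Dja | ] := eqVneq j a; last by rewrite subrr.
move: eq_ij; rewrite Dja eqxx [a == a']eq_sym (negPf neq_a) => + /negPf neq_ia.
rewrite neq_ia subr0 sub0r eq_sym -subr_eq0 opprK.
by case: (i == a'); rewrite -natrD pnatr_eq0.
Qed.

End TwoFamilies.

End Families.

(** * Counting over all families at once *)

Section Counting.

Local Open Scope ring_scope.

Variables (gT : finGroupType) (G : {group gT}) (I : finType).
Variables (A : I -> {set gT}) (q : I -> nat) (Y : I -> {set Iirr G}).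
Variable al : I -> Iirr G -> 'CF(G).

Hypothesis oddG : odd #|G|.
Hypothesis exc : forall i, exceptional (A i) (q i) (Y i) (al i).
Hypothesis tiA : forall i j, i != j -> [disjoint A i & A j].
Hypothesis defG1 : \bigcup_i A i = G^#.
Hypothesis nsAG : forall i, A i <| G.

Let notA1 i : 1%g \notin A i.
Proof.
have := setD11 1%g G; rewrite -defG1; apply: contraFN => A1; apply/bigcupP; by exists i.
Qed.

Lemma mass_sum (phi : 'CF(G)) : \sum_i mass (A i) phi = #|G|%:R * '[phi] - `|phi 1%g| ^+ 2.
Proof.
rewrite -(partition_disjoint_bigcup _ _ tiA) defG1.
rewrite (cfnormE (cfun_onG phi)) mulVKf ?neq0CG //.
by rewrite [in RHS](big_setD1 1%g) ?group1 //=; rewrite addrAC subrr add0r.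
Qed.

(* The families met by al i a in all their members; by parity, if j is not one
   of them then every al j b involves 'chi_a. *)
Definition out i a := [set j | (j != i) && [forall b in Y j, '[al i a, 'chi_b] != 0]].

(** [al i a] has norm [q i + 1] and integral multiplicities, hence at most [q i + 1] constituents.
    The principal character and a member of [Y i] are two of them, besides all of [Y j] for [j] in
    [out i a]. *)
Lemma column_bound i a : a \in Y i -> (\sum_(j in out i a) #|Y j| < q i)%N.
Proof.
move=> Ya; pose T := [set c | '[al i a, 'chi_c] != 0].
have leT: (#|T| <= (q i).+1)%N.
  have: '[al i a] = (q i).+1%:R by rewrite (exc_dot (exc i)) // eqxx addn1.
  rewrite cfdot_sum_irr -(ler_nat algC) => <-.
  rewrite (bigID (mem T)) /= -sum1_card natr_sum ler_wpDr //.
    by apply: sumr_ge0 => c _; rewrite -normCK exprn_ge0.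
  apply: ler_sum => c; rewrite inE => nz; rewrite -normCK intr_normK ?(exc_irr (exc i)) //.
  by rewrite sqr_intr_ge1 // (exc_irr (exc i)).
have [b0 Yb0 nzb0] := exc_own (exc i) Ya.
have Y'0 j: 0 \notin Y j.
  by apply/negP => /(exc_neq (exc j)); rewrite conjC_Iirr0 eqxx.
have nz0: '[al i a, 'chi_0] != 0 by rewrite irr0 (exc_cfun1 (exc i)) ?oner_neq0.
pose F j := if j \in out i a then Y j else set0.
have tiF j k: j != k -> [disjoint F j & F k].
  move=> neq_jk; rewrite -setI_eq0 /F; case: ifP => _; rewrite ?set0I //.
  case: ifP => _; rewrite ?setI0 // setI_eq0.
  exact: exc_disjoint (exc j) (exc k) (tiA neq_jk).
have ->: (\sum_(j in out i a) #|Y j| = #|\bigcup_j F j|)%N.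
  rewrite -sum1_card (partition_disjoint_bigcup _ _ tiF) /= [LHS]big_mkcond /=.
  by apply: eq_bigr => j _; rewrite sum1_card /F; case: ifP; rewrite ?cards0.
rewrite -ltnS (leq_trans _ leT) //.
have [notF0 notFb0]: 0 \notin \bigcup_j F j /\ b0 \notin \bigcup_j F j.
  split; apply/bigcupP=> [[j _]]; rewrite /F; case: ifP; rewrite ?inE // => /andP[neq_ji _].
    exact/negP.
  by apply/negP; rewrite (disjointFl (exc_disjoint (exc j) (exc i) (tiA neq_ji))).
have ->: (#|\bigcup_j F j|.+2 = #|(0%R : Iirr G) |: (b0 |: \bigcup_j F j)|)%N.
  rewrite !cardsU1 notFb0 !inE negb_or notF0.
  by rewrite (contraTneq _ Yb0) // => <-.
apply/subset_leq_card/subsetP=> c /setU1P[-> | /setU1P[-> | /bigcupP[j _]]]; rewrite ?inE //.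
rewrite /F; case: ifP; rewrite ?inE // => /andP[_ /forall_inP Yj /Yj//].
Qed.

(* Covers the case d = 1 or -1; for larger multiplicities the same bound follows
   from mass_Cauchy. *)
Hypothesis unit_mass : forall i a d, `|d| = 1 -> {in Y i, forall b, '[al i b, 'chi_a] = d} ->
  #|A i|%:R <= mass (A i) 'chi_a.
Hypothesis leAq : forall i, (#|A i| * q i < #|G|)%N.
Hypothesis Ygt0 : forall i, (0 < #|Y i|)%N.

(** Some [b] in [Y j] is missing from [al i a], so by parity [al j b] involves ['chi_a], with a
    multiplicity independent of [b]. If it is 1 or -1, [unit_mass] applies; otherwise [mass_Cauchy]
    suffices, as [#|A j| * (q j + 1) <= 2 * #|G|]. *)
Lemma row_mass i j a : a \in Y i -> j != i -> j \notin out i a ->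
  #|A j|%:R <= mass (A j) 'chi_a.
Proof.
move=> Ya neq_ji; rewrite inE neq_ji /= negb_forall => /existsP[b].
rewrite negb_imply negbK => /andP[Yb /eqP ab0].
have tij: [disjoint A i & A j] by rewrite tiA // eq_sym.
have nz_ba := exc_parity (exc i) (exc j) tij oddG Ya Yb ab0.
have Zba := exc_irr (exc j) a Yb.
have [d1 | d_neq1] := eqVneq `|'[al j b, 'chi_a]| 1.
  apply: unit_mass d1 _ => c Yc.
  by rewrite (exc_const (exc i) (exc j) tij (notA1 j) Ya Yc Yb).
have [n Dn] := natrP (natr_norm_int Zba).
have n_ge2: (2 <= n)%N.
  rewrite -(normr_eq0 (V := algC)) Dn pnatr_eq0 in nz_ba; rewrite Dn (eqr_nat _ n 1) in d_neq1.
  by case: n nz_ba d_neq1 {Dn} => [|[|]].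
have Al: al j b \in 'CF(G, A j) by rewrite (zchar_on (exc_vchar (exc j) Yb)).
have := mass_Cauchy 'chi_a (nsAG j) Al; rewrite cfdotC norm_conjC Dn.
rewrite (exc_dot (exc j)) // eqxx -natrX -natrM => leM.
rewrite -(ler_pM2r (_ : 0 < (q j + 1)%:R)) ?ltr0n ?addn1 //.
rewrite addn1 in leM; apply: le_trans leM; rewrite -natrM ler_nat.
have q_gt0: (0 < q j)%N := leq_ltn_trans (leq0n _) (column_bound Yb).
have leA2: (#|A j| * (q j).+1 <= 2 * #|G|)%N.
  by have := leAq j; rewrite mulnS; have := leq_pmulr #|A j| q_gt0; lia.
by rewrite (leq_trans leA2) // leq_mul2r (@leq_trans (2 ^ 2)) ?orbT // leq_exp2r.
Qed.

(** The total mass of ['chi_a] on [G^#] is at most [#|G| - 1], the sum of all [#|A j|]. By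
    [row_mass] the families outside [out i a] take at least their share, which limits what is left
    for [A i]. *)
Lemma row_bound i a (x y : nat) : a \in Y i -> x%:R * #|G|%:R <= y%:R * mass (A i) 'chi_a ->
  (x * #|G| <= y * (#|A i| + \sum_(j in out i a) #|A j|))%N.
Proof.
move=> Ya lexy; rewrite -(ler_nat algC) !natrM (le_trans lexy) // ler_wpM2l ?ler0n //.
have le1: \sum_j mass (A j) 'chi_a <= \sum_j #|A j|%:R.
  rewrite mass_sum cfnorm_irr mulr1 -natr_sum.
  have ->: (\sum_j #|A j| = #|G|.-1)%N.
    rewrite (eq_bigr (fun j => \sum_(x in A j) 1)%N) => [|j _]; last by rewrite sum1_card.
    by rewrite -(partition_disjoint_bigcup _ _ tiA) defG1 sum1_card (cardsD1 1%g G) group1.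
  rewrite -subn1 natrB ?cardG_gt0 // lerD2l lerN2.
  by rewrite exprn_ege1 // norm_intr_ge1 ?irr1_neq0 // intrE Cnat_irr1.
have outE: (\sum_(j in out i a) #|A j| = \sum_(j | (j != i) && (j \in out i a)) #|A j|)%N.
  by apply: eq_bigl => j; rewrite inE; case: (j != i).
rewrite (bigD1 i) //= [in leRHS](bigD1 i) //= in le1.
rewrite (bigID [in out i a]) /= [in leRHS](bigID [in out i a]) /= in le1.
rewrite -(lerD2r (\sum_(j | (j != i) && (j \notin out i a)) #|A j|%:R)).
rewrite outE natrD natr_sum -addrA; apply: le_trans le1.
rewrite lerD2l -[leLHS]add0r lerD ?sumr_ge0 // => [j _|].
  exact: mass_ge0.
by apply: ler_sum => j /andP[neq_ji]; apply: row_mass.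
Qed.

Lemma exc_card_gt1 i : (1 < #|Y i|)%N.
Proof.
have /card_gt0P[a Ya] := Ygt0 i.
rewrite (cardsD1 a) Ya ltnS card_gt0; apply/set0Pn; exists (conjC_Iirr a).
by rewrite !inE (exc_neq (exc i)) ?(exc_conjY (exc i)).
Qed.

Lemma out_leq i a (m : nat) : a \in Y i -> (forall j, j != i -> m <= q j)%N ->
  ((#|out i a|.*2 < q i) /\ (m * \sum_(j in out i a) #|A j| <= #|out i a| * #|G|))%N.
Proof.
move=> Ya le_m; split.
  apply: leq_ltn_trans (column_bound Ya); rewrite -muln2 -sum_nat_const.
  by apply: leq_sum => j _; apply: exc_card_gt1.
rewrite big_distrr -sum_nat_const /=; apply: leq_sum => j; rewrite inE => /andP[neq_ji _].
by rewrite mulnC (leq_trans _ (ltnW (leAq j))) // leq_mul2l le_m ?orbT.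
Qed.

(* Comparing, for a family i with q i minimal, the column bound on the number of
   families in out i a with the bound of row_bound on their total size.  When
   #|Y i| > 2 the latter uses the vector of norm 12 from exc_three; otherwise
   i is the only family with this q i and #|Y i| = 2, and only q i = 3 needs
   the sharper estimate on #|A i|. *)
Lemma counting_contradiction :
    (forall i, 2 < q i)%N -> (forall i, odd (q i)) ->
    (forall i j, q i = q j -> #|Y i| = #|Y j| -> i = j) ->
    (forall i, q i = 3 -> #|Y i| = 2 -> 7 * #|A i| <= 2 * #|G|)%N ->
  (0 < #|I|)%N -> False.
Proof.
move=> q_gt2 odd_q injq q3 /card_gt0P[i0 _].
have [i1 _ min1] := arg_minnP q (isT : xpredT i0).
have G_gt0 := cardG_gt0 G.
have [/existsP[i /andP[/eqP Dqi Yi3]] | noY3] := boolP [exists i, (q i == q i1) && (2 < #|Y i|)%N].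
  have /card_gt0P[a0 Ya0] := Ygt0 i.
  have [a Ya [v [Av nv dv]]] := exc_three (exc i) Ya0 Yi3 (notA1 i).
  have := mass_Cauchy 'chi_a (nsAG i) Av; rewrite dv nv [leRHS]mulrC.
  move/(row_bound Ya) => rowi.
  have [j _ | ltU leA] := @out_leq i a (q i) Ya; first by rewrite Dqi min1.
  (* With [k = q i] and [u = #|out i a|], the bounds give [9 k < 12 + 12 u <= 6 k + 6], against
     [2 < k]. *)
  have := leAq i; have := q_gt2 i; move: (q i) #|G| #|A i| (\sum_(j in _) _)%N #|out i a| ltU leA rowi G_gt0.
  move=> k g x y u; rewrite -addnn => ltU leA row g_gt0 gt_k2 ltxk; nia.
have /card_gt0P[a Ya] := Ygt0 i1.
have Y2 i: q i = q i1 -> #|Y i| = 2%N.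
  move=> Dq; apply/eqP; rewrite eqn_leq exc_card_gt1 andbT leqNgt.
  by apply: contra noY3 => ?; apply/existsP; exists i; rewrite Dq eqxx.
(* By [injq] the least value of [q] occurs only once, and all values are odd. *)
have le_q2 j: j != i1 -> ((q i1).+2 <= q j)%N.
  move=> neq_j1; rewrite ltn_neqAle eq_sym; have le1j := min1 j isT.
  have lt1j: (q i1 < q j)%N.
    rewrite ltn_neqAle le1j andbT; apply: contraNneq neq_j1 => Dq.
    by apply/eqP/injq; rewrite // !Y2.
  rewrite lt1j andbT; apply: contraTneq (odd_q j) => ->.
  by rewrite /= odd_q.
have [ltU leA] := out_leq Ya le_q2.
have Av: al i1 (conjC_Iirr a) - al i1 a \in 'CF(G, A i1).
  by rewrite rpredB ?(zchar_on (exc_vchar (exc i1) _)) ?(exc_conjY (exc i1)).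
have := mass_Cauchy 'chi_a (nsAG i1) Av; rewrite (exc_half_bound (exc i1)) //.
rewrite (exc_diff (exc i1)) // cfnormBd ?cfnorm_irr; last first.
  by rewrite cfdot_irr eq_sym (negPf (exc_neq (exc i1) Ya)).
rewrite -[1 + 1]/(2%:R) -[1 : algC]/(1%:R) [leRHS]mulrC => /(row_bound Ya); rewrite mul1n.
have := q3 i1; rewrite Y2 // => /(_ _ erefl); have := leAq i1; have := q_gt2 i1; have := odd_q i1.
move: (q i1) #|G| #|A i1| (\sum_(j in _) _)%N #|out i1 a| ltU leA G_gt0.
move=> k g x y u; rewrite -addnn => ltU leA g_gt0 odd_k gt_k2 ltxk x7 row.
have le_k4: (k <= 4)%N.
  rewrite leqNgt; apply/negP=> gt_k4.
  have := leq_mul (ltnW ltxk) (leqnn (2 * (k + 2))).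
  have := leq_mul (leqnn (2 * k)) leA; have := leq_mul (leqnn (k * (k + 2))) row.
  have := leq_mul ltU (leqnn (k * g)); have := leq_mul gt_k4 (leqnn g).
  nia.
have Dk: k = 3%N by case: k odd_k gt_k2 le_k4 {ltU leA ltxk row x7} => [|[|[|[|[|]]]]].
(* Now [u <= 1], so [x <= 2 g / 7] and [y <= g / 5], and twice their sum is less than [g]. *)
have le7 := x7 Dk; subst k; nia.
Qed.

End Counting.

(** * Zeros of characters at elements of prime order *)

Section NonVanishing.

Local Open Scope ring_scope.

Variables (gT : finGroupType) (G : {group gT}).
Implicit Types (a : Iirr G) (p : nat).

(* Galois conjugation propagates the zero at x to all generators of <[x]>, so
   '['Res 'chi_a, 1] = 'chi_a 1 / p is an integer. *)
Lemma irr_prime_order_eq0 a p x : x \in G -> #[x]%g = p -> prime p ->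
  'chi_a x = 0 -> (p %| 'chi_a 1%g)%C.
Proof.
move=> Gx ox p_pr chi_x0; pose H := <[x]>%G.
have sHG: H \subset G by rewrite cycle_subG.
have Hx: x \in H := cycle_id x.
have ResX k: 'chi_a (x ^+ k)%g = \sum_i '['Res[H] 'chi_a, 'chi_i] * 'chi_i x ^+ k.
  have Hxk: (x ^+ k)%g \in H by rewrite groupX.
  rewrite -(cfResE 'chi_a sHG) // {1}['Res[H] _]cfun_sum_cfdot sum_cfunE.
  apply: eq_bigr => i _; rewrite cfunE; have lin_i := irr_cyclic_lin i (cycle_cyclic x).
  by rewrite lin_charX.
have chi_gen y: y \in H^# -> 'chi_a y = 0.
  case/setD1P=> nty /cyclePmin[k ltkx Dy].
  have co_kp: coprime k p.
    rewrite coprime_sym prime_coprime // gtnNdvd -?ox // lt0n.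
    by apply: contraNneq nty => k0; rewrite Dy k0.
  have [u Du] := Qn_aut_exists co_kp.
  transitivity (u ('chi_a (x ^+ 1)%g)); last by rewrite expg1 chi_x0 rmorph0.
  rewrite Dy !ResX rmorph_sum; apply: eq_bigr => i _; rewrite rmorphM expr1 /=; congr (_ * _).
    by rewrite aut_intr // Cint_cfdot_vchar_irr // cfRes_vchar ?irr_vchar.
  by rewrite Du // -ox lin_char_unity_root ?irr_cyclic_lin ?cycle_cyclic.
have: '['Res[H] 'chi_a, 1] = p%:R^-1 * 'chi_a 1%g.
  rewrite cfdotE -orderE ox (big_setD1 1%g) //= big1 => [|y Hy].
    by rewrite addr0 cfRes1 cfun11 conjC1 mulr1.
  have [_ Hy1] := setD1P Hy; rewrite cfResE // chi_gen ?mul0r //.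
move=> Dm; apply/dvdCP; exists '['Res[H] 'chi_a, 1].
  by rewrite Cint_cfdot_vchar ?cfRes_vchar ?irr_vchar ?cfun1_vchar.
by rewrite Dm mulrC mulVKf // pnatr_eq0 -lt0n prime_gt0.
Qed.

(** The nonzero values at the generators of [<[x]>] have squared moduli of mean at least 1. Summing
    over pairs [(x, y)] generating the same subgroup averages this over [A]. *)
Lemma nonvanishing_mass (A : {set gT}) a p : prime p -> A \subset G ->
    {in A, forall x, #[x]%g = p} -> {in A, forall x y, generator <[x]> y -> y \in A} ->
    {in A, forall x, 'chi_a x != 0} ->
  #|A|%:R <= mass A 'chi_a.
Proof.
move=> p_pr sAG oA genA nzA; have p1_gt0: 0 < p.-1%:R :> algC.
  by rewrite ltr0n -ltnS prednK ?prime_gt0 ?prime_gt1.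
have card_gen x: x \in A -> #|[set y | generator <[x]> y]| = p.-1.
  by move=> Ax; rewrite -totient_gen oA // totient_prime.
rewrite -(ler_pM2r p1_gt0).
have ->: mass A 'chi_a * p.-1%:R = \sum_(x in A) \sum_(y | generator <[x]> y) `|'chi_a y| ^+ 2.
  rewrite (exchange_big_dep (mem A)) /=; last by move=> x y Ax; apply: genA.
  rewrite mulr_suml; apply: eq_bigr => y Ay; rewrite sumr_const mulr_natr; congr (_ *+ _).
  rewrite -(card_gen y Ay) -cardsE; apply/esym/eq_card => x; rewrite !inE.
  apply/andP/idP=> [[_] | genx]; first by rewrite /generator eq_sym.
  by split; [apply: genA genx | rewrite /generator eq_sym].
rewrite mulr_natl -sumr_const.
apply: ler_sum => x Ax; have sxG: <[x]> \subset G by rewrite cycle_subG (subsetP sAG).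
have -> : p.-1%:R = #|[pred s | generator <[x]> s]|%:R :> algC.
  by rewrite -(card_gen x Ax) cardsE.
have := @sum_norm2_char_generators _ <[x]>%G ('Res 'chi_a) (cfRes_char _ (irr_char a)).
rewrite /= => le1; apply: le_trans (le1 _) _ => [s gen_s|].
  by rewrite cfResE ?cycle_generator // nzA // (genA x).
rewrite le_eqVlt; apply/orP; left; apply/eqP/eq_bigr => s gen_s.
by rewrite cfResE ?cycle_generator.
Qed.

End NonVanishing.

(** * Exceptional characters from a Frobenius normaliser with TI kernel *)

Section TrivialIntersection.

Local Open Scope ring_scope.

Variables (gT : finGroupType) (G N P : {group gT}).
Hypotheses (oddG : odd #|G|) (tiP : normedTI P^# G N) (frobN : [Frobenius N with kernel P]).

Let q := #|N : P|.
Let sNG : N \subset G. Proof. by have /normedTI_memJ_P[] := tiP. Qed.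
Let nsPN : P <| N. Proof. by have [] := Frobenius_kerP frobN. Qed.
Let sPN : P \subset N. Proof. exact: normal_sub. Qed.
Let sPG : P \subset G. Proof. exact: subset_trans sPN sNG. Qed.
Let oddN : odd #|N|. Proof. exact: dvdn_odd (cardSg sNG) oddG. Qed.

Lemma cfInd_normedTI (phi : 'CF(N)) x :
  phi \in 'CF(N, P^#) -> x \in P^# -> 'Ind[G] phi x = phi x.
Proof.
have [_ _ memJ] := normedTI_memJ_P tiP.
move=> Pphi P1x; rewrite cfIndE // (big_setID N) /= (setIidPr sNG) addrC big1 ?add0r.
  rewrite (eq_bigr (fun=> phi x)) => [|y Ny]; last by rewrite cfunJ.
  by rewrite sumr_const -[phi x *+ _]mulr_natl mulKf ?neq0CG.
by move=> y /setDP[Gy notNy]; rewrite (cfun_on0 Pphi) // memJ.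
Qed.

Lemma cfdot_Ind_normedTI (phi psi : 'CF(N)) :
    phi \in 'CF(N, P^#) -> psi \in 'CF(N, P^#) ->
  '['Ind[G] phi, 'Ind[G] psi] = '[phi, psi].
Proof.
move=> Pphi Ppsi; rewrite -cfdot_Res_l !(cfdotEr _ Ppsi); congr (_ * _).
apply: eq_bigr => x Px; rewrite cfResE ?cfInd_normedTI //.
by rewrite (subsetP sPN) //; case/setD1P: Px.
Qed.

(** The regular character of [N / P] lifted to [N]; its degree [q] is that of the members of [X], so
    that [beta] below vanishes at 1. *)
Let psi0 : 'CF(N) := 'Ind[N, P] 1.
Let linP := [pred i : Iirr P | ('chi_i \is a linear_char) && (i != 0)].
Let indI (i : Iirr P) : Iirr N := cfIirr ('Ind[N] 'chi_i).
Let X : {set Iirr N} := [set indI i | i in linP].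

Let indIE i : i != 0 -> 'chi_(indI i) = 'Ind[N] 'chi_i.
Proof. by move=> nz_i; rewrite cfIirrE ?irr_induced_Frobenius_ker. Qed.

(** A nontrivial character of [P] has an orbit of [q] conjugates under [N], so each member of [X] is
    induced from exactly [q] nontrivial linear characters. *)
Let card_X : (#|X| * q + 1 = #|P : P^`(1)|)%N.
Proof.
have inertiaP i : i != 0 -> #|N : 'I_N['chi[P]_i]| = q.
  by move=> nz_i; rewrite inertia_Frobenius_ker.
have fiber i j : i != 0 -> j != 0 -> (indI i == indI j) = (j \in cfclass_Iirr N i).
  move=> nz_i nz_j; rewrite cfclass_IirrE; apply/eqP/idP=> [eq_ij | cl_ij]; last first.
    by apply: irr_inj; rewrite !indIE //; apply: cfclass_Ind.
  have consttI k : k != 0 -> k \in irr_constt ('Res[P] 'chi_(indI k)).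
    move=> nz_k; rewrite irr_consttE cfdot_Res_l -indIE //.
    by rewrite cfnorm_irr oner_neq0.
  have := consttI j nz_j; rewrite -eq_ij irr_consttE.
  rewrite (Clifford_Res_sum_cfclass nsPN (consttI i nz_i)) cfdotZl cfdot_suml.
  rewrite reindex_cfclass //=; apply: contraR => not_cl.
  rewrite big1 ?mulr0 // => k cl_k; rewrite cfdot_irr.
  by case: eqP => // Dk; rewrite -Dk cl_k in not_cl.
have lin0: [pred i | 'chi[P]_i \is a linear_char] 0 by rewrite /= irr0 cfun1_lin_char.
rewrite -card_lin_irr (cardD1x lin0) addnC; congr addn.
have <-: #|linP| = #|[pred i | [pred i | 'chi[P]_i \is a linear_char] i & i != 0]|.
  by apply: eq_card.
rewrite -[in RHS]sum1_card (partition_big_imset indI) /= -/X.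
transitivity (\sum_(k in X) q)%N; first by rewrite sum_nat_const.
apply: eq_bigr => k /imsetP[i /andP[lin_i nz_i] ->].
rewrite sum1_card -(inertiaP i nz_i) -card_cfclass_Iirr //.
apply: eq_card => j; rewrite [RHS]unfold_in /= [indI j == _]eq_sym.
apply/idP/andP=> [cl_ij | [/andP[lin_j nz_j]]]; last by rewrite fiber.
have [y Ny Dj] := imsetP cl_ij.
have nz_j : j != 0 by rewrite Dj conjg_Iirr_eq0.
split; last by rewrite fiber.
by rewrite unfold_in /= nz_j Dj conjg_IirrE cfConjg_lin_char.
Qed.

Let Xirr k : k \in X -> exists i, [/\ 'chi[P]_i \is a linear_char, i != 0 & 'chi_k = 'Ind[N] 'chi_i].
Proof. by case/imsetP=> i /andP[lin_i nz_i] ->; exists i; rewrite indIE. Qed.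

Let X1 k : k \in X -> 'chi_k 1%g = q%:R.
Proof.
by case/Xirr=> i [lin_i _ ->]; rewrite cfInd1 // lin_char1 // mulr1.
Qed.

Let Xon k : k \in X -> 'chi_k \in 'CF(N, P).
Proof. by case/Xirr=> i [_ _ ->]; apply: cfInd_normal. Qed.

Let Xdot0 k : k \in X -> '[psi0, 'chi_k] = 0.
Proof.
move=> Xk; have notPk: ~~ (P \subset cfker 'chi_k).
  by apply/(Frobenius_Ind_irrP frobN); have [i [_ nz_i ->]] := Xirr Xk; exists i.
rewrite cfdotC -cfdot_Res_l -irr0; apply/eqP; rewrite conjC_eq0.
by apply: contraNT notPk => nz; apply: constt0_Res_cfker; rewrite // irr_consttE.
Qed.

Let XconjC k : k \in X -> conjC_Iirr k \in X.
Proof.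
case/imsetP=> i linPi ->; have /andP[lin_i nz_i] := linPi.
apply/imsetP; exists (conjC_Iirr i).
  by rewrite inE conjC_IirrE cfConjC_lin_char lin_i conjC_Iirr_eq0.
by apply: irr_inj; rewrite conjC_IirrE !indIE ?conjC_Iirr_eq0 // conjC_IirrE cfAutInd.
Qed.

Let Xneq k : k \in X -> conjC_Iirr k != k.
Proof.
move=> Xk; apply: odd_conjC_Iirr_neq => //; apply: contraTneq Xk => ->.
apply/negP=> /Xdot0; rewrite irr0 /psi0 cfdotC -cfdot_Res_l cfRes_cfun1 cfnorm1.
by move/eqP; rewrite conjC1 oner_eq0.
Qed.

Let beta k : 'CF(N) := psi0 - 'chi_k.

Let psi0_1 : psi0 1%g = q%:R.
Proof. by rewrite cfInd1 // cfun11 mulr1. Qed.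

Let beta_vchar k : k \in X -> beta k \in 'Z[irr N, P^#].
Proof.
move=> Xk; rewrite zchar_split cfun_onD1 rpredB ?irr_vchar ?cfInd_vchar ?cfun1_vchar //=.
by rewrite rpredB ?Xon ?cfInd_normal //= !cfunE psi0_1 X1 ?subrr.
Qed.

Let beta_on k : k \in X -> beta k \in 'CF(N, P^#).
Proof. by move/beta_vchar/zchar_on. Qed.

Let beta_dot k l : k \in X -> l \in X -> '[beta k, beta l] = (q + (k == l))%:R.
Proof.
move=> Xk Xl; rewrite cfdotBl !cfdotBr Xdot0 // cfdotC ['['chi_k, _]]cfdotC.
rewrite Xdot0 // conjC0 subr0 sub0r opprK cfnorm_Ind_cfun1 // cfdot_irr.
by rewrite conjC_nat natrD.
Qed.

Let al k : 'CF(G) := 'Ind[G] (beta k).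

Let al_dot k l : k \in X -> l \in X -> '[al k, al l] = (q + (k == l))%:R.
Proof. by move=> Xk Xl; rewrite cfdot_Ind_normedTI ?beta_on // beta_dot. Qed.

Let al_cfun1 k : k \in X -> '[al k, 1] = 1.
Proof.
move=> Xk; rewrite -cfdot_Res_r cfRes_cfun1 cfdotBl -cfdot_Res_r cfRes_cfun1 cfnorm1.
rewrite -irr0 cfdot_irr (_ : k == 0 = false) ?subr0 //.
by apply: contraNF (Xneq Xk) => /eqP->; rewrite conjC_Iirr0.
Qed.

Let psi0C : (psi0^*)%CF = psi0.
Proof. by rewrite cfAutInd cfConjC_cfun1. Qed.

Let al_conj k : k \in X -> al (conjC_Iirr k) = ((al k)^*)%CF.
Proof. by move=> Xk; rewrite cfAutInd rmorphB /= psi0C -conjC_IirrE. Qed.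

(** The difference vanishes at 1 and has norm 2, hence is some ['chi_a - 'chi_b]; complex
    conjugation negates it, so the two characters are conjugate. *)
Let al_diff k : k \in X ->
  exists a, al (conjC_Iirr k) - al k = 'chi_a - 'chi_(conjC_Iirr a).
Proof.
move=> Xk; have Xk' := XconjC Xk; set h := al _ - al _.
have hJ: (h^*)%CF = - h by rewrite rmorphB /= -!al_conj // conjC_IirrK opprB.
have [|| a [b neq_ba Dh]] := @vchar_norm2 _ _ h.
- rewrite zcharD1E rpredB ?cfInd_vchar ?(zcharW (beta_vchar _)) //= !cfunE.
  by rewrite !cfInd1 // !(cfun_on0 (beta_on _)) ?mulr0 ?subrr ?setD11.
- rewrite cfnormB !al_dot // !eqxx (negPf (Xneq Xk)) conjC_nat addn0 addn1.
  by rewrite -natr1; ring.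
exists a; rewrite Dh; congr (_ - 'chi_(_)).
have := congr1 (cfdotr 'chi_b) hJ; rewrite /cfdotr /= Dh rmorphB /= -!conjC_IirrE.
rewrite cfdotNl !cfdotBl !cfdot_irr eqxx [a == b]eq_sym (negPf neq_ba) sub0r opprK.
case: eqP => [-> // | _] /eqP; rewrite sub0r.
case: (_ == b); rewrite ?oppr0 1?eq_sym ?oner_eq0 // -subr_eq0 opprK.
by rewrite -natrD pnatr_eq0.
Qed.

(** [Y] is the image of [X] under the map [mu] obtained from [al_diff]. It is injective because the
    differences attached to distinct [k] and [l] have inner product at most 0, not 2. *)
Lemma exceptional_normedTI :
  exists Y : {set Iirr G}, exists al : Iirr G -> 'CF(G),
  [/\ (#|Y| * #|N : P| + 1 = #|P : P^`(1)|)%N,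
      exceptional (class_support P^# G) #|N : P| Y al
    & forall i : Iirr P, 'chi_i \is a linear_char -> i != 0 ->
      exists2 a, a \in Y & al a = 'Ind[G] (1 - 'chi_i)].
Proof.
have /fin_all_exists[mu muP] (k : Iirr N) : exists a, k \in X ->
    al (conjC_Iirr k) - al k = 'chi_a - 'chi_(conjC_Iirr a).
  have [Xk | notXk] := boolP (k \in X); last by exists 0.
  by have [a Da] := al_diff Xk; exists a.
have norm_diff k: k \in X -> '[al (conjC_Iirr k) - al k] = 2%:R.
  move=> Xk; rewrite cfnormB !al_dot ?XconjC // !eqxx (negPf (Xneq Xk)) conjC_nat.
  by rewrite addn0 addn1 -natr1; ring.
have mu_neq k: k \in X -> conjC_Iirr (mu k) != mu k.
  move=> Xk; apply: contra_eqN (norm_diff k Xk) => /eqP eq_mu.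
  by rewrite muP // eq_mu subrr cfdot0l eq_sym pnatr_eq0.
have mu_inj: {in X &, injective mu}.
  move=> k l Xk Xl eq_mu; apply: contraTeq isT => neq_kl.
  have: '[al (conjC_Iirr k) - al k, al (conjC_Iirr l) - al l] == 2%:R.
    by rewrite -(norm_diff k Xk) !muP // eq_mu.
  rewrite cfdotBl !cfdotBr !al_dot ?XconjC // (inj_eq (inv_inj (@conjC_IirrK _ N))).
  rewrite (negPf neq_kl) !natrD addr0 -subr_eq0.
  set x := (_ == l : nat); set y := (k == _ : nat).
  have ->: q%:R - (q%:R + x%:R) - (q%:R + y%:R - q%:R) - 2%:R = - (x + y + 2)%:R :> algC.
    by rewrite !natrD; ring.
  by rewrite oppr_eq0 pnatr_eq0 addn2.
have mu_conj k: k \in X -> mu (conjC_Iirr k) = conjC_Iirr (mu k).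
  move=> Xk; have Xk' := XconjC Xk.
  have := congr1 (cfdotr 'chi_(mu (conjC_Iirr k))) (muP _ Xk').
  rewrite conjC_IirrK -opprB muP // opprB /cfdotr /= !cfdotBl !cfdot_irr eqxx.
  rewrite (negPf (mu_neq _ Xk')) subr0; case: eqP => // _ /eqP.
  by rewrite sub0r eq_sym -subr_eq0 opprK -natrD pnatr_eq0.
(* [nu] inverts [mu] on its image, with default 0 elsewhere, so that [al] can be indexed by
   [Iirr G]. *)
pose nu a := odflt 0 [pick k in X | mu k == a].
have nuK k: k \in X -> nu (mu k) = k.
  rewrite /nu => Xk; case: pickP => [l /andP[Xl /eqP eq_mu] | /(_ k)]; first exact: mu_inj.
  by rewrite Xk eqxx.
exists (mu @: X), (fun a => al (nu a)); split.
- by rewrite card_in_imset.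
- split=> [_ /imsetP[k Xk ->] | _ _ /imsetP[k Xk ->] /imsetP[l Xl ->] | | | | | ].
  + rewrite nuK // zchar_split cfInd_vchar ?(zcharW (beta_vchar Xk)) //=.
    by rewrite cfInd_on ?beta_on.
  + by rewrite !nuK // al_dot // (inj_in_eq mu_inj).
  + by move=> _ /imsetP[k Xk ->]; rewrite nuK // al_cfun1.
  + by move=> _ /imsetP[k Xk ->]; rewrite -mu_conj // imset_f // XconjC.
  + by move=> _ /imsetP[k Xk ->]; apply: mu_neq.
  + by move=> _ /imsetP[k Xk ->]; rewrite -mu_conj // !nuK ?XconjC // al_conj.
  by move=> _ /imsetP[k Xk ->]; rewrite -mu_conj // !nuK ?XconjC // muP // mu_conj.
move=> i lin_i nz_i; have Xi: indI i \in X by rewrite imset_f // unfold_in /= lin_i.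
exists (mu (indI i)); first exact: imset_f.
by rewrite nuK // /al /beta indIE // -linearB cfIndInd.
Qed.

End TrivialIntersection.

(** * Degrees modulo p and the case of multiplicity 1 or -1 *)

Section UnitMass.

Local Open Scope ring_scope.

Variables (gT : finGroupType) (G P : {group gT}) (p : nat).
Hypotheses (p_pr : prime p) (pP : p.-group P) (ntP : P :!=: 1%g) (sPG : P \subset G).

(* The nonlinear characters of P have degrees divisible by p, and so does the
   number of linear ones. *)
Lemma irr1_mod_linear a d : d \in Num.int ->
    (forall i : Iirr P, 'chi_i \is a linear_char -> i != 0 ->
       '['Ind[G] (1 - 'chi_i), 'chi_a] = d) ->
  (p %| 'chi_a 1%g - d)%C.
Proof.
move=> Zd dE; pose c i := '['Res[P] 'chi_a, 'chi_i].
have Zc i: c i \in Num.int by rewrite Cint_cfdot_vchar_irr ?cfRes_vchar ?irr_vchar.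
have cE i: 'chi_i \is a linear_char -> i != 0 -> c i = c 0 - d.
  move=> lin_i nz_i; rewrite -(dE i) // -cfdot_Res_r cfdotC cfdotBr -irr0 -!/(c _).
  by rewrite rmorphB /= !conj_intr // opprB addrC subrK.
have p_lin: (p %| #|P : P^`(1)%g|%:R)%C.
  rewrite dvdC_nat; have [_ _ [k oP]] := pgroup_pdiv pP ntP.
  have: p.-nat #|P : P^`(1)%g| by apply: pnat_dvd pP; apply: dvdn_indexg.
  case/p_natP=> [[|m] Dm]; last by rewrite Dm dvdn_exp.
  move/eqP: Dm; rewrite indexg_eq1.
  by rewrite (negPf (proper_subn (sol_der1_proper (pgroup_sol pP) (subxx P) ntP))).
have ->: 'chi_a 1%g = \sum_i c i * 'chi_i 1%g.
  rewrite -(cfRes1 P) {1}['Res _]cfun_sum_cfdot sum_cfunE.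
  by apply: eq_bigr => i _; rewrite cfunE.
rewrite (bigID (fun i => 'chi_i \is a linear_char)) /= addrAC rpredD //; last first.
  apply: rpred_sum => i not_lin; rewrite dvdC_mull //.
  have := dvd_irr1_cardG i; have [n Dn] := natrP (Cnat_irr1 i); rewrite Dn !dvdC_nat => dv_nP.
  have /p_natP[[|m] Dm] : p.-nat n by apply: pnat_dvd dv_nP pP.
    by rewrite qualifE /= irr_char Dn Dm eqxx in not_lin.
  by rewrite Dm dvdn_exp.
have lin0 : 'chi[P]_0 \is a linear_char by rewrite irr0 cfun1_lin_char.
rewrite (eq_bigr (fun i => (c 0 - d) + (i == 0)%:R * d)) => [|i lin_i]; last first.
  rewrite lin_char1 // mulr1; have [-> | nz_i] := eqVneq i 0; first by rewrite mul1r subrK.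
  by rewrite mul0r addr0 cE.
rewrite big_split /= sumr_const [X in _ *+ X](_ : _ = #|P : P^`(1)%g|); last first.
  by rewrite -card_lin_irr.
rewrite (bigD1 0) //= ?eqxx mul1r big1 ?addr0 => [|i /andP[_ /negPf->]]; last by rewrite mul0r.
by rewrite addrK -mulr_natr dvdC_mull ?rpredB.
Qed.

(** A zero of ['chi_a] on the support would make [p] divide the degree of ['chi_a], hence also [d]
    by [irr1_mod_linear]. So [nonvanishing_mass] applies. *)
Lemma exceptional_mass a d : d \in Num.int -> `|d| = 1 ->
    {in P^#%g, forall x, #[x]%g = p} ->
    (forall i : Iirr P, 'chi_i \is a linear_char -> i != 0 ->
       '['Ind[G] (1 - 'chi_i), 'chi_a] = d) ->
  #|class_support P^#%g G|%:R <= mass (class_support P^#%g G) 'chi_a.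
Proof.
move=> Zd d1 oP dE.
have sAG: class_support P^#%g G \subset G.
  by rewrite class_support_subG // (subset_trans (subsetDl _ _)).
have oA: {in class_support P^#%g G, forall x, #[x]%g = p}.
  by move=> _ /imset2P[x y P1x Gy ->]; rewrite orderJ oP.
apply: (nonvanishing_mass p_pr sAG oA) => [_ /imset2P[x y P1x Gy ->] z gen_z | x Ax].
  have /setD1P[ntx Px] := P1x.
  have /cycleP[k Dz] := cycle_generator gen_z.
  rewrite Dz -conjXg imset2_f // !inE groupX // andbT.
  apply: contraTneq gen_z => xk1; rewrite Dz -conjXg xk1 conj1g /generator cycle1.
  by rewrite cycle_eq1 conjg_eq1.
apply/eqP=> chi_x0; have p_chi1 := irr_prime_order_eq0 (subsetP sAG x Ax) (oA x Ax) p_pr chi_x0.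
have: (p %| d)%C by rewrite -[d](subKr ('chi_a 1%g)) rpredB // irr1_mod_linear.
case/dvdCP=> z Zz Dd; have [n Dn] := natrP (natr_norm_int Zz).
move/eqP: d1; rewrite Dd normrM Dn normr_nat -natrM (eqr_nat _ _ 1) muln_eq1.
by rewrite (gtn_eqF (prime_gt1 p_pr)) andbF.
Qed.

End UnitMass.

(** * Sylow subgroups of a minimal insoluble group *)

Section MinimalSimple.

Variables (gT : finGroupType) (G : {group gT}).
Implicit Types (D H P R S T : {group gT}) (p q r : nat).

(** Let [S] be the normal Sylow [r]-subgroup from [solvable_prime_orders]. If [r != p], then [S]
    centralises [D]; since centralisers of nontrivial elements of [D] are [p]-groups, [S] is
    trivial, and [H] has prime order and equals [D]. *)
Lemma prime_orders_normal_pgroup p D H :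
    prime_orders H -> solvable H -> prime p -> D <| H -> p.-group D -> D :!=: 1 ->
  exists2 T : {group gT}, p.-Sylow(H) T & T <| H /\ (T :=: H \/ prime #|H : T|).
Proof.
move=> poH solH p_pr nsDH pD ntD; have [sDH nDH] := andP nsDH.
have [r [S [r_pr sylS nsSH oHS]]] := solvable_prime_orders solH poH.
have [sSH rS _] := and3P sylS.
have [-> | neq_pr] := eqVneq p r; first by exists S.
have tiDS : D :&: S = 1.
  by apply: coprime_TIg; rewrite (pnat_coprime pD) //; apply: sub_in_pnat rS => t _;
  rewrite !inE => /eqP->; rewrite eq_sym.
have cDS : D \subset 'C(S).
  apply/commG1P/trivgP; rewrite -tiDS commg_subI //; rewrite subsetI subxx /=.
    by rewrite (subset_trans sDH) ?normal_norm.
  by rewrite (subset_trans sSH).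
have S1 : S :=: 1.
  have [x Dx ntx] := trivgPn _ ntD.
  have Hx : x \in H^# by rewrite !inE ntx (subsetP sDH).
  have ox : #[x] = p := prime_orders_pelt poH Hx (mem_p_elt pD Dx).
  have pS : p.-group S.
    have := prime_orders_cent1 poH Hx; rewrite ox; apply: pgroupS.
    by rewrite subsetI sSH sub_cent1 (subsetP cDS).
  apply: card1_trivg; rewrite -(part_pnat_id pS) part_p'nat //.
  by apply: sub_in_pnat rS => t _; rewrite !inE => /eqP->; rewrite eq_sym.
rewrite S1 in oHS.
have defH : D :=: H.
  case: oHS => [H1 | prH]; first by case/eqP: ntD; apply/trivgP; rewrite H1.
  rewrite indexg1 in prH; apply/eqP; rewrite eqEcard sDH dvdn_leq ?cardG_gt0 //.
  move/primeP: prH => [_ /(_ _ (cardSg sDH))]; rewrite -trivg_card1 (negPf ntD) /=.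
  by move/eqP->.
exists D; last by split; [|left].
by rewrite pHallE sDH -{1}defH /= part_pnat_id.
Qed.

Hypotheses (poG : prime_orders G) (nsolG : ~~ solvable G).
Hypothesis solG_proper : forall H, H \proper G -> solvable H.
Hypothesis simpleG : forall H, H <| G -> H :=: 1 \/ H :=: G.

Let norm_proper p D : p.-group D -> D \subset G -> D :!=: 1 -> 'N_G(D) \proper G.
Proof.
move=> pD sDG ntD; rewrite properE subsetIl subsetI subxx /=.
apply: contra nsolG => nDG; case: (@simpleG D) => [|D1|<-]; first exact/andP.
  by rewrite D1 eqxx in ntD.
exact: pgroup_sol pD.
Qed.

(** Downward induction on the order of [D = P :&: R]. If [P] and [R] differ, the normalisers of [D]
    in both are larger than [D] and lie in the normal Sylow subgroup [T] of ['N_G(D)]. A Sylow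
    subgroup [U] containing [T] then equals both by induction. *)
Lemma Sylow_TI p P R : prime p -> p.-Sylow(G) P -> p.-Sylow(G) R ->
  P :&: R != 1 -> P :=: R.
Proof.
move=> p_pr; have [n] := ubnP (#|G| - #|P :&: R|); elim: n => // n IHn in P R *.
rewrite ltnS => leGn sylP sylR ntD; apply/eqP; apply: contraT => neq_PR.
have [[sPG pP _] [sRG pR _]] := (and3P sylP, and3P sylR).
pose D := (P :&: R)%G; have sDG : D \subset G by rewrite subIset ?sPG.
have pD : p.-group D := pgroupS (subsetIl P R) pP.
have prN := norm_proper pD sDG ntD.
have sNG := proper_sub prN.
have poN := prime_ordersS sNG poG.
have [T sylT [nsT _]] := prime_orders_normal_pgroup poN (solG_proper prN) p_pr
  (normalSG sDG) pD ntD.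
have [U sylU sTU] := Sylow_superset (subset_trans (pHall_sub sylT) sNG) (pHall_pgroup sylT).
have eqU (Q : {group gT}) : p.-Sylow(G) Q -> D \proper Q -> Q :=: U.
  move=> sylQ prDQ; have [sQG pQ _] := and3P sylQ.
  have ltD := nilpotent_proper_norm (pgroup_nil pQ) prDQ.
  have sNQT : 'N_Q(D) \subset T.
    by rewrite (sub_normal_Hall sylT nsT) ?setSI // (pgroupS (subsetIl _ _)).
  have sNQU : 'N_Q(D) \subset Q :&: U by rewrite subsetI subsetIl (subset_trans sNQT).
  have ltDU : #|D| < #|Q :&: U| := leq_trans (proper_card ltD) (subset_leq_card sNQU).
  apply: IHn => //; last first.
    by rewrite -cardG_gt1; apply: leq_ltn_trans ltDU; rewrite cardG_gt0.
  apply: leq_trans leGn; rewrite ltn_sub2l //.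
  by apply: leq_trans ltDU _; rewrite subset_leq_card // subIset ?sQG.
have oPR : #|P| = #|R| by rewrite (card_Hall sylP) (card_Hall sylR).
have prDP : D \proper P.
  rewrite properE subsetIl subsetI subxx /=.
  by apply: contraNN neq_PR => sPR; rewrite eqEcard sPR oPR leqnn.
have prDR : D \proper R.
  rewrite properE subsetIr subsetI subxx andbT /=.
  by apply: contraNN neq_PR => sRP; rewrite eq_sym eqEcard sRP oPR leqnn.
have := eqU P sylP prDP; rewrite -(eqU R sylR prDR) => eqPR.
by rewrite eqPR eqxx in neq_PR.
Qed.

Section OneSylow.

Variables (p : nat) (P : {group gT}).
Hypotheses (p_pr : prime p) (p_dv_G : p %| #|G|) (sylP : p.-Sylow(G) P).

Let sPG : P \subset G. Proof. exact: pHall_sub sylP. Qed.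
Let pP : p.-group P. Proof. exact: pHall_pgroup sylP. Qed.

Lemma Sylow_neq1 : P :!=: 1.
Proof. by rewrite -cardG_gt1 (card_Hall sylP) p_part_gt1 mem_primes p_pr cardG_gt0. Qed.

Lemma Sylow_order : {in P^#, forall x, #[x] = p}.
Proof.
move=> x /setD1P[ntx Px]; apply: prime_orders_pelt poG _ (mem_p_elt pP Px).
by rewrite !inE ntx (subsetP sPG).
Qed.

Lemma Sylow_normedTI : normedTI P^# G 'N_G(P).
Proof.
apply/normedTI_P; split; first by rewrite setD_eq0 subG1 Sylow_neq1.
  by rewrite normD1.
move=> g Gg; rewrite disjoint_sym -setI_eq0 => ntI; rewrite inE Gg; apply/normP.
have sylPg : p.-Sylow(G) (P :^ g)%G by rewrite pHallJ.
apply: Sylow_TI p_pr sylPg sylP _.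
have [x] := set0Pn _ ntI; rewrite conjD1g !inE => /andP[/andP[ntx Pgx] /andP[_ Px]].
by apply/trivgPn; exists x; rewrite // inE Pgx.
Qed.

(** A self-normalising [P] would be a Frobenius complement in [G], whose kernel contradicts
    simplicity. Otherwise [P] is a Frobenius kernel of its normaliser, since centralisers of its
    nontrivial elements are [p]-groups. *)
Lemma Sylow_Frobenius :
  [Frobenius 'N_G(P) with kernel P] /\ prime #|'N_G(P) : P|.
Proof.
have ntP := Sylow_neq1; have prN := norm_proper pP sPG ntP; have sNG := proper_sub prN.
have nsPN : P <| 'N_G(P) := normalSG sPG.
have neqNP : P :!=: 'N_G(P).
  apply/eqP=> defN; have frobG : [Frobenius G with complement P].
    rewrite /Frobenius_group_with_complement {1}defN proper_neq //=.
    by rewrite {2}defN Sylow_normedTI.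
  have [K frobK] := Frobenius_kernel_exists frobG.
  have [defG ntK _ ltKG _] := Frobenius_context frobK.
  have [nsKG _ _ _ _] := sdprod_context defG.
  case: (simpleG nsKG) => [K1|eqKG]; first by rewrite K1 eqxx in ntK.
  by rewrite eqKG properxx in ltKG.
have prNP : prime #|'N_G(P) : P|.
  have [T sylT [nsT oT]] := prime_orders_normal_pgroup (prime_ordersS sNG poG)
    (solG_proper prN) p_pr nsPN pP ntP.
  have defT : P :=: T.
    have sPT : P \subset T by rewrite (sub_normal_Hall sylT nsT) // normal_sub.
    apply/eqP; rewrite eqEcard sPT (card_Hall sylP) (card_Hall sylT).
    by rewrite dvdn_leq ?part_gt0 // partn_dvd ?cardG_gt0 // cardSg.
  case: oT => [eqT | ]; last by rewrite -defT.
  by case/eqP: neqNP; apply: etrans defT eqT.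
split=> //; apply/Frobenius_kerP; split=> // [|x P1x].
  by rewrite properEneq neqNP normal_sub.
have [ntx Px] := setD1P P1x; have Gx : x \in G^# by rewrite !inE ntx (subsetP sPG).
have sylPN : p.-Sylow('N_G(P)) P := pHall_subl (normal_sub nsPN) sNG sylP.
rewrite (sub_normal_Hall sylPN) ?subsetIl // -(Sylow_order P1x).
by apply: pgroupS (prime_orders_cent1 poG Gx); rewrite setSI.
Qed.

End OneSylow.

End MinimalSimple.

Lemma odd_minimal_simple (gT : finGroupType) (G : {group gT}) :
    prime_orders G -> odd #|G| -> ~~ solvable G ->
    (forall H : {group gT}, H \proper G -> solvable H) ->
    (forall H : {group gT}, H <| G -> H :=: 1 \/ H :=: G) ->
  False.
Proof.
move=> poG oddG nsolG solG_proper simpleG.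
pose I : finType := {p : 'I_#|G|.+1 | prime p && (p %| #|G|)}.
pose pr (i : I) : nat := val (val i).
have pr_prime i : prime (pr i) by case/andP: (valP i).
have pr_dvd i : pr i %| #|G| by case/andP: (valP i).
pose P (i : I) : {group gT} := sval (Sylow_exists (pr i) G).
have sylP i : (pr i).-Sylow(G) (P i) := svalP (Sylow_exists (pr i) G).
have sPG i : P i \subset G := pHall_sub (sylP i).
have pP i : (pr i).-group (P i) := pHall_pgroup (sylP i).
have ntP i : P i :!=: 1 := Sylow_neq1 (pr_prime i) (pr_dvd i) (sylP i).
pose N i := 'N_G(P i)%G; pose q i := #|N i : P i|.
have tiP i : normedTI (P i)^# G (N i).
  have TI := Sylow_normedTI poG nsolG solG_proper simpleG (pr_prime i) (pr_dvd i).
  exact: TI (sylP i).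
have FrobN i : [Frobenius N i with kernel P i] /\ prime (q i).
  have Frob := Sylow_Frobenius poG nsolG solG_proper simpleG (pr_prime i) (pr_dvd i).
  exact: Frob (sylP i).
have oP i : {in (P i)^#, forall x, #[x] = pr i} := Sylow_order poG (sylP i).
pose A i := class_support (P i)^# G.
have oA i x : x \in A i -> #[x] = pr i.
  by case/imset2P=> y z P1y _ ->; rewrite orderJ (oP i).
have sNG i : N i \subset G by apply: subsetIl.
have sPN i : P i \subset N i by rewrite subsetI sPG normG.
have nsAG i : A i <| G.
  by rewrite /normal class_support_norm class_support_subG // (subset_trans (subsetDl _ _)).
have pr_inj i j : pr i = pr j -> i = j by move=> eq_ij; do 2!apply: val_inj.
have tiA i j : i != j -> [disjoint A i & A j].
  move=> neq_ij; rewrite -setI_eq0; apply: contraNT neq_ij => /set0Pn[x /setIP[Aix Ajx]].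
  by apply/eqP/pr_inj; rewrite -(oA i x) // (oA j).
have defG1 : \bigcup_i A i = G^#.
  apply/setP=> x; apply/bigcupP/idP=> [[i _ Ax] | G1x].
    rewrite !inE (subsetP (normal_sub (nsAG i))) // andbT -order_eq1 (oA i x) //.
    by rewrite gtn_eqF ?prime_gt1.
  have [ntx Gx] := setD1P G1x; have x_pr := poG x G1x.
  have ltxG : #[x] < #|G|.+1 by rewrite ltnS dvdn_leq ?order_dvdG.
  have prx : prime (Ordinal ltxG) && (Ordinal ltxG %| #|G|) by rewrite x_pr order_dvdG.
  exists (Sub (Ordinal ltxG) prx) => //; set i : I := Sub _ _.
  have pX : (pr i).-group <[x]> by rewrite /pgroup -orderE pnat_id.
  have sXG : <[x]> \subset G by rewrite cycle_subG.
  have [y Gy sXPy] := Sylow_subJ (sylP i) sXG pX.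
  apply/imset2P; exists (x ^ y^-1) y => //; last by rewrite conjgKV.
  by rewrite !inE conjg_eq1 ntx -mem_conjg -cycle_subG.
have /fin_all_exists[Y /fin_all_exists[al excY]] i := exceptional_normedTI oddG (tiP i) (FrobN i).1.
have exc i : exceptional (A i) (q i) (Y i) (al i) by case: (excY i).
have cardY i : (#|Y i| * q i + 1 = #|P i : (P i)^`(1)|)%N by case: (excY i).
have oG i : #|G| = (#|P i| * q i * #|G : N i|)%N by rewrite Lagrange // Lagrange.
have cardA i : #|A i| = (#|P i|.-1 * #|G : N i|)%N.
  by rewrite (card_support_normedTI (tiP i)) (cardsD1 1 (P i)) group1.
have q_prime i : prime (q i) by case: (FrobN i).
have odd_q i : odd (q i).
  by apply: dvdn_odd oddG; rewrite (oG i) dvdn_mulr // dvdn_mull.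
have q_gt2 i : 2 < q i by apply: odd_prime_gt2.
have indexP i : exists m, #|P i : (P i)^`(1)| = (pr i ^ m.+1)%N.
  have: (pr i).-nat #|P i : (P i)^`(1)| by apply: pnat_dvd (pP i); apply: dvdn_indexg.
  case/p_natP=> [[|m] Dm]; last by exists m.
  move/eqP: Dm; rewrite indexg_eq1.
  by rewrite (negPf (proper_subn (sol_der1_proper (pgroup_sol (pP i)) (subxx _) (ntP i)))).
have Y_gt0 i : 0 < #|Y i|.
  rewrite lt0n; apply/eqP=> Y0; have := cardY i; have [m ->] := indexP i.
  rewrite Y0 expnS => /esym/eqP; rewrite muln_eq1.
  by rewrite (gtn_eqF (prime_gt1 (pr_prime i))).
apply: (counting_contradiction oddG exc tiA defG1 nsAG) => //.
- move=> i a d d1 dE; have /card_gt0P[b0 Yb0] := Y_gt0 i.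
  have Zd : d \in Num.int by rewrite -(dE b0 Yb0) (exc_irr (exc i)).
  apply: (exceptional_mass (pr_prime i) (pP i) (ntP i) (sPG i) Zd d1 (oP i)) => j lin_j nz_j.
  by have [_ _ /(_ j lin_j nz_j)[b Yb <-]] := excY i; apply: dE.
- move=> i; rewrite cardA (oG i) mulnAC ltn_pmul2r ?indexg_gt0 // ltn_pmul2r ?indexg_gt0 //.
  by rewrite prednK.
(* [#|Y i| * q i + 1] is a nontrivial power of [pr i], so it determines this prime. *)
- move=> i j eq_q eq_Y; apply: pr_inj.
  have [[m Dm] [n Dn]] := (indexP i, indexP j).
  have : pr i %| pr j ^ n.+1 by rewrite -Dn -cardY -eq_q -eq_Y cardY Dm expnS dvdn_mulr.
  by rewrite Euclid_dvdX // dvdn_prime2 // => /andP[/eqP].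
(* An abelianisation of order 7 makes [P i] cyclic of order 7, whence [#|A i| / #|G| = 6 / 21]. *)
- move=> i q3 Y2; have idx7 : #|P i : (P i)^`(1)| = 7 by rewrite -cardY q3 Y2.
  have cycP : cyclic (P i).
    apply: cyclic_nilpotent_quo_der1_cyclic; first exact: pgroup_nil (pP i).
    by apply: prime_cyclic; rewrite card_quotient ?der_norm // idx7.
  have oP7 : #|P i| = 7.
    by rewrite -idx7 (derG1P (cyclic_abelian cycP)) indexg1.
  by rewrite cardA (oG i) oP7 q3 !mulnA.
have ltpG : pdiv #|G| < #|G|.+1 by rewrite ltnS dvdn_leq ?pdiv_dvd.
have ntG : 1 < #|G|.
  by rewrite cardG_gt1; apply: contraNneq nsolG => ->; apply: solvable1.
have prG : prime (Ordinal ltpG) && (Ordinal ltpG %| #|G|) by rewrite pdiv_prime ?pdiv_dvd.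
by apply/card_gt0P; exists (Sub (Ordinal ltpG) prG).
Qed.

Theorem odd_prime_orders_solvable (gT : finGroupType) (G : {group gT}) :
  prime_orders G -> odd #|G| -> solvable G.
Proof.
have [n] := ubnP #|G|; elim: n => // n IHn in gT G *; rewrite ltnS => leGn poG oddG.
have solsub (H : {group gT}) : H \proper G -> solvable H.
  move=> prH; apply: IHn; first exact: leq_trans (proper_card prH) leGn.
    exact: prime_ordersS (proper_sub prH) poG.
  exact: dvdn_odd (cardSg (proper_sub prH)) oddG.
apply: contraT => nsolG; exfalso; apply: (odd_minimal_simple poG oddG nsolG solsub) => H nsHG.
have [sHG nHG] := andP nsHG.
have [-> | ntH] := eqVneq (gval H) 1; [by left | right; apply/eqP].
apply: contraNT nsolG => neqHG; rewrite (series_sol nsHG) solsub ?properEneq ?neqHG //=.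
apply: IHn; last by rewrite quotient_odd.
  by apply: leq_trans leGn; rewrite ltn_quotient.
exact: prime_orders_quotient.
Qed.

(** * Groups of even order *)

Lemma card_rest_arith q nQ nE :
    (0 < q -> 2 * nQ = q.-1 * (q.+1 * q.+2) ->
     q.+1 * q * q.+2 = 1 + q * q.+2 + nQ + nE -> 2 * nE = q * q.+1 ^ 2)%N.
Proof. by rewrite -mulnn; case: q => // k _ /=; lia. Qed.

(** If the last bound were not strict, the four bounds would add up to exactly the left side. *)
Lemma sum_inv_arith q nQ nE n1 nI nQ' nE' :
    (0 < q -> 2 * nQ = q.-1 * (q.+1 * q.+2) -> 2 * nE = q * q.+1 ^ 2 ->
     n1 <= q * q.+2 -> nI <= q * q.+2 * q -> nQ' <= nQ * q -> nE' < nE * q.+2 ->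
   q * q.+2 * (q * q.+2).+1 <> n1 + nI + nQ' + nE')%N.
Proof.
rewrite -mulnn; case: q => // k _ /= hQ hE h1 hI hQ' hE'.
have: (2 * (nQ * k.+1) = k * (k.+2 * k.+3) * k.+1)%N by rewrite mulnA hQ.
have: (2 * (nE * k.+3) = k.+1 * (k.+2 * k.+2) * k.+3)%N by rewrite mulnA hE.
lia.
Qed.

Lemma dvdn3_prod n : (3 %| n * (n.+1 * n.+2))%N.
Proof.
by rewrite !Euclid_dvdM //; have := ltn_pmod n (isT : 0 < 3); rewrite /dvdn; lia.
Qed.

Section EvenNonsolvable.

Variables (gT : finGroupType) (G P : {group gT}).
Hypotheses (poG : prime_orders G) (nsolG : ~~ solvable G) (sylP : 2.-Sylow(G) P).

Let B := 'N_G(P)%G.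
Let I := [set x in G | #[x] == 2].

Let sPG : P \subset G. Proof. exact: pHall_sub sylP. Qed.
Let pP : 2.-group P. Proof. exact: pHall_pgroup sylP. Qed.
Let sBG : B \subset G. Proof. exact: subsetIl. Qed.
Let nsPB : P <| B. Proof. exact: normalSG sPG. Qed.
Let sPB : P \subset B. Proof. exact: normal_sub. Qed.

Lemma Syl2_neq1 : P :!=: 1.
Proof.
apply: contra nsolG => /eqP P1; apply: odd_prime_orders_solvable => //.
apply: contraT; rewrite -dvdn2 => dv2G; have := card_Hall sylP.
rewrite P1 cards1 => /esym/eqP; rewrite p_part_eq1 mem_primes /= dv2G cardG_gt0 //.
Qed.

Lemma involution_Syl2 x : x \in G -> x != 1 -> 2.-elt x -> x \in I.
Proof.
by move=> Gx ntx elx; rewrite inE Gx (@prime_orders_pelt _ G 2) // !inE ntx.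
Qed.

Lemma involutionP x : x \in I -> [/\ x \in G, x != 1, x ^+ 2 = 1 & 2.-elt x].
Proof.
rewrite inE => /andP[Gx /eqP ox]; split; rewrite // -?order_gt1 ?ox //.
  by rewrite -ox expg_order.
by rewrite /p_elt ox.
Qed.

Lemma involutionV x : x \in I -> x^-1 = x.
Proof.
case/involutionP=> _ _ x2 _; apply: (mulIg x); rewrite mulVg -x2.
by rewrite expgS expg1.
Qed.

Lemma Syl2_abelem : 2.-abelem P.
Proof.
apply: exponent2_abelem; apply/exponentP=> x Px.
by rewrite (prime_orders_expn poG) ?(subsetP sPG) // (mem_p_elt pP).
Qed.

Let cPP : abelian P. Proof. exact: abelem_abelian Syl2_abelem. Qed.

Lemma Syl2_cent1 x : x \in P^# -> 'C_G[x] = P.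
Proof.
move=> P1x; have [ntx Px] := setD1P P1x; have Gx := subsetP sPG x Px.
have ox : #[x] = 2.
  by apply: prime_orders_pelt poG _ (mem_p_elt pP Px); rewrite !inE ntx.
have pC : 2.-group 'C_G[x].
  by rewrite -{1}ox; apply: prime_orders_cent1 poG _; rewrite !inE ntx.
apply: (sub_pHall sylP pC); rewrite ?subsetIl // subsetI sPG sub_cent1.
exact: subsetP cPP x Px.
Qed.

Lemma Syl2_normedTI : normedTI P^# G B.
Proof.
apply/normedTI_P; split; first by rewrite setD_eq0 subG1 Syl2_neq1.
  by rewrite normD1.
move=> g Gg; rewrite -setI_eq0 => /set0Pn[x /setIP[P1x /imsetP[y P1y Dx]]].
rewrite inE Gg; apply/normP; rewrite -[in RHS](Syl2_cent1 P1x).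
by rewrite Dx cent1J -[in RHS](conjGid Gg) -conjIg Syl2_cent1.
Qed.

Lemma involution_support : I = class_support P^# G.
Proof.
apply/setP=> x; apply/idP/imset2P=> [/involutionP[Gx ntx _ elx] | [y g P1y Gg ->]].
  have sXG : <[x]> \subset G by rewrite cycle_subG.
  have [g Gg sXPg] := Sylow_subJ sylP sXG elx.
  exists (x ^ g^-1) g => //; last by rewrite conjgKV.
  by rewrite !inE conjg_eq1 ntx -mem_conjg -cycle_subG.
have [nty Py] := setD1P P1y; apply: involution_Syl2; rewrite ?conjg_eq1 //.
  by rewrite groupJ // (subsetP sPG).
by rewrite p_eltJ (mem_p_elt pP).
Qed.

Lemma card_involution : #|I| = (#|P|.-1 * #|G : B|)%N.
Proof.
by rewrite involution_support (card_support_normedTI Syl2_normedTI) (cardsD1 1 P) group1.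
Qed.

Lemma Syl2_norm_pelt x : x \in B -> 2.-elt x -> x \in P.
Proof.
move=> Bx elx; have sylPB : 2.-Sylow(B) P := pHall_subl sPB sBG sylP.
by rewrite -cycle_subG (sub_normal_Hall sylPB) ?cycle_subG.
Qed.

Lemma involution_norm x : x \in I -> x \in B -> x \in P.
Proof. by case/involutionP=> _ _ _ elx Bx; apply: Syl2_norm_pelt. Qed.

Lemma Syl2_involution x : x \in P^# -> x \in I.
Proof.
case/setD1P=> ntx Px; apply: involution_Syl2 ntx (mem_p_elt pP Px).
exact: (subsetP sPG).
Qed.

Lemma norm_Syl2_proper : B \proper G.
Proof.
rewrite properE sBG; apply: contra nsolG => sGB.
have nsPG : P <| G by rewrite /normal sPG (subset_trans sGB) ?subsetIr.
rewrite (series_sol nsPG) (pgroup_sol pP) odd_prime_orders_solvable //.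
  exact: prime_orders_quotient.
by rewrite card_quotient ?normal_norm // odd_2'nat; case/and3P: sylP.
Qed.

Let eqBx x u : u \in B :* x -> B :^ u = B :^ x.
Proof. by case/rcosetP=> b Bb ->; rewrite conjsgM conjGid. Qed.

(** For [t] in [P^#], the map [d |-> t ^ d] sends the intersection into [P^#]; it is injective
    because ['C_G[t] = P] meets the intersection trivially. *)
Lemma card_norm_meet u : u \in G -> u \notin B -> #|B :&: B :^ u| <= #|P|.-1.
Proof.
move=> Gu notBu; have [t Pt ntt] := trivgPn _ Syl2_neq1.
have P1t : t \in P^# by rewrite !inE ntt.
have tiDP : B :&: B :^ u :&: P = 1.
  apply/trivgP/subsetP=> x /setIP[/setIP[_ /imsetP[y By Dx]] Px]; rewrite inE.
  apply: contraR notBu => ntx; have [_ _ memJ] := normedTI_memJ_P Syl2_normedTI.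
  have Py : y \in P by rewrite (Syl2_norm_pelt By) // -(p_eltJ _ _ u) -Dx (mem_p_elt pP).
  by rewrite -(memJ y) // -?Dx !inE ?ntx // Py -(conjg_eq1 y u) -Dx ntx.
have injt : {in B :&: B :^ u &, injective (fun d => t ^ d)}.
  move=> d1 d2 Dd1 Dd2 /= eq_t; apply/eqP; rewrite eq_mulgV1 -in_set1 -[[set 1]]tiDP.
  rewrite in_setI groupM ?groupV //= -(Syl2_cent1 P1t) inE.
  have [[Bd1 _] [Bd2 _]] := (setIP Dd1, setIP Dd2).
  rewrite groupM ?groupV ?(subsetP sBG) //= cent1C; apply/cent1P/commgP/conjg_fixP.
  by rewrite conjgM eq_t conjgK.
rewrite -(card_in_imset injt) (cardsD1 1 P) group1 subset_leq_card //.
apply/subsetP=> _ /imsetP[d /setIP[Bd _] ->].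
by rewrite memJ_norm // normD1; case/setIP: Bd.
Qed.

(** Given an involution [u] in the coset, [v |-> v * u] matches the involutions of the coset with
    the elements of [B :&: B :^ u] inverted by [u]. *)
Lemma card_coset_involution x : x \in G -> x \notin B ->
  #|I :&: (B :* x)| <= #|P|.-1 /\
  (#|I :&: (B :* x)| = #|P|.-1 -> exists u,
    [/\ u \in I, u \in B :* x, #|B :&: B :^ u| = #|P|.-1
      & {in B :&: B :^ u, forall y, y ^ u = y^-1}]).
Proof.
move=> Gx notBx; have Gt0 : 0 < #|P|.-1 by rewrite -ltnS prednK ?cardG_gt0 // cardG_gt1 Syl2_neq1.
have [I0 | [u /setIP[Iu Bxu]]] := set_0Vmem (I :&: (B :* x)).
  by rewrite I0 cards0; split=> // n0; rewrite -n0 in Gt0.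
have [Gu ntu u2 _] := involutionP Iu.
have notBu : u \notin B by case/rcosetP: Bxu => b Bb ->; rewrite groupMl.
have uV := involutionV Iu; have uu : u * u = 1 by rewrite -{1}uV mulVg.
pose inv := [set y in B :&: B :^ u | y ^ u == y^-1].
have Dinv : I :&: (B :* x) = inv :* u.
  apply/setP=> v; rewrite mem_rcoset uV; have Bxvu: (v \in B :* x) = (v * u \in B).
    by rewrite -(rcoset_eqP Bxu) mem_rcoset uV.
  rewrite in_setI Bxvu [in RHS]inE; apply/andP/andP=> [[Iv Bvu] | [/setIP[Bvu _] /eqP vuJ]].
    have vuJ : (v * u) ^ u = (v * u)^-1.
      by rewrite conjgE -mulgA uu mulg1 invMg uV (involutionV Iv).
    by rewrite vuJ eqxx inE Bvu mem_conjg uV vuJ groupV.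
  split=> //; have vv : v * v = 1.
    have uvE : u * v = (v * u)^-1 by rewrite -vuJ conjgE -[v * u * u]mulgA uu mulg1 uV.
    by rewrite -{1}[v]mulg1 -uu mulgA -[_ * u * v]mulgA uvE mulgV.
  have Gv : v \in G by rewrite -[v]mulg1 -uu mulgA groupM // (subsetP sBG).
  rewrite inE Gv; apply/eqP/nt_prime_order; rewrite // ?expgS ?expg1 //.
  by apply: contraNneq notBu => v1; rewrite -[u]mul1g -v1.
have sinv : inv \subset B :&: B :^ u by apply/subsetP=> y; rewrite inE => /andP[].
have leD := card_norm_meet Gu notBu.
rewrite Dinv card_rcoset; split=> [|inv_n]; first exact: leq_trans (subset_leq_card sinv) leD.
have eqD : inv = B :&: B :^ u by apply/eqP; rewrite eqEcard sinv inv_n.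
exists u; split=> // [|y]; first by rewrite -eqD.
by rewrite -eqD inE => /andP[_ /eqP].
Qed.

(* A coset outside B meets I in at most #|P| - 1 elements, and this bound is
   also the average over all these cosets, hence attained by each of them. *)
Lemma coset_involution x : x \in G -> x \notin B -> exists u,
    [/\ u \in I, u \in B :* x, #|B :&: B :^ u| = #|P|.-1
      & {in B :&: B :^ u, forall y, y ^ u = y^-1}].
Proof.
move=> Gx notBx; apply: (card_coset_involution Gx notBx).2.
pose C := rcosets B G :\ gval B; pose f (y : gT) := B :* y.
have Cmem y : y \in G -> y \notin B -> B :* y \in C.
  move=> Gy notBy; apply/setD1P; split; last by apply/rcosetsP; exists y.
  by apply: contraNneq notBy => <-; apply: rcoset_refl.
have Cf y : y \in I :\: B -> f y \in C.
  by case/setDP=> /involutionP[Gy _ _ _]; apply: Cmem.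
have oIB : #|I :\: B| = (\sum_(X in C) #|I :&: X|)%N.
  rewrite -sum1_card (partition_big f (mem C)) //=; apply: eq_bigr => X CX.
  rewrite sum1_card; apply: eq_card => y; rewrite [LHS]unfold_in /=.
  have [neqXB /rcosetsP[z Gz DX]] := setD1P CX.
  have -> : (f y == X) = (y \in X).
    by rewrite DX /f; apply/eqP/idP => [<- | /rcoset_eqP //]; apply: rcoset_refl.
  rewrite in_setI in_setD andbC [RHS]andbC; case Xy : (y \in X) => //=.
  suffices -> : y \notin B by [].
  apply: contraNN neqXB => By; rewrite DX in Xy *.
  by rewrite -(rcoset_eqP Xy) rcoset_id.
have oC : #|C| = #|G : B|.-1.
  rewrite /indexg (cardsD1 (gval B) (rcosets B G)).
  by have -> : gval B \in rcosets B G by apply/rcosetsP; exists 1; rewrite ?mulg1.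
have leC X : X \in C -> #|I :&: X| <= #|P|.-1.
  case/setD1P=> neqXB /rcosetsP[z Gz DX]; rewrite DX.
  apply: (card_coset_involution Gz _).1; apply: contraNN neqXB => Bz.
  by rewrite DX rcoset_id.
have IB : #|I :&: B| = #|P|.-1.
  have -> : I :&: B = P^#.
    apply/setP=> y; apply/setIP/setD1P=> [[Iy By] | [nty Py]].
      by split; [case/involutionP: Iy | apply: involution_norm].
    by split; [apply: Syl2_involution; rewrite !inE nty | apply: (subsetP sPB)].
  by rewrite (cardsD1 1 P) group1.
have oIB2 : #|I :\: B| = (#|C| * #|P|.-1)%N.
  rewrite cardsD IB card_involution oC mulnC -{1}[#|G : B|]prednK ?indexg_gt0 //.
  by rewrite mulSn addnC addnK.
apply/eqP; rewrite eqn_leq (card_coset_involution Gx notBx).1 /= leqNgt.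
apply/negP=> ltx; have CBx := Cmem x Gx notBx.
have : \sum_(X in C) #|I :&: X| < \sum_(X in C) #|P|.-1.
  rewrite (bigD1 (B :* x)) //= [X in _ < X](bigD1 (B :* x)) //= -addSn leq_add //.
  by apply: leq_sum => X /andP[CX _]; apply: leC.
by rewrite -oIB oIB2 sum_nat_const ltnn.
Qed.

(** If [P] had order 2, then [B] would centralise its involution and equal [P], making [G] a
    Frobenius group with complement [P] and a kernel of odd order, hence soluble. *)
Lemma Syl2_card_gt2 : 2 < #|P|.
Proof.
have gtP1 : 1 < #|P| by rewrite cardG_gt1 Syl2_neq1.
rewrite ltn_neqAle gtP1 andbT; apply: contra nsolG => /eqP oP.
have [t Pt ntt] := trivgPn _ Syl2_neq1.
have P1t : t \in P^# by rewrite !inE ntt.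
have P1E : P^# = [set t].
  apply/esym/eqP; rewrite eqEcard sub1set P1t cards1 /= -ltnS oP (cardsD1 1 P).
  by rewrite group1.
have defB : B :=: P.
  apply/eqP; rewrite eqEsubset sPB andbT; apply/subsetP=> b Bb.
  have [Gb nPb] := setIP Bb; rewrite -(Syl2_cent1 P1t) inE Gb cent1C.
  apply/cent1P/commgP/conjg_fixP/set1P; rewrite -P1E.
  by rewrite memJ_norm // normD1.
have frobG : [Frobenius G with complement P].
  apply/andP; split; last by rewrite -{2}defB Syl2_normedTI.
  by rewrite -defB proper_neq // norm_Syl2_proper.
have [K frobK] := Frobenius_kernel_exists frobG.
have [defG _ _ _ _] := Frobenius_context frobK.
have [nsKG _ mulKP _ _] := sdprod_context defG.
have coKP := Frobenius_coprime frobK.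
rewrite (series_sol nsKG) -mulKP quotientMidl quotient_sol ?(pgroup_sol pP) // andbT.
apply: odd_prime_orders_solvable; first exact: prime_ordersS (normal_sub nsKG) poG.
by rewrite -oP coprimen2 in coKP.
Qed.

(** Being inverted by [u], the intersection is abelian. By [prime_orders_noaction] on [P], any of
    its nontrivial elements generates it. *)
Lemma even_configuration : exists u, [/\ u \in I, u \notin B,
  prime #|P|.-1, #|B :&: B :^ u| = #|P|.-1 & {in B :&: B :^ u, forall y, y ^ u = y^-1}].
Proof.
have [x Gx notBx] : exists2 x, x \in G & x \notin B.
  by apply/subsetPn; case/andP: norm_Syl2_proper.
have [u [Iu Bxu oD invD]] := coset_involution Gx notBx.
have notBu : u \notin B by case/rcosetP: Bxu => b Bb ->; rewrite groupMl.
exists u; split=> //; rewrite -oD; pose D := (B :&: B :^ u)%G.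
have abD y z : y \in D -> z \in D -> commute y z.
  move=> Dy Dz; apply: invg_inj; rewrite -invD ?groupM // conjMg !invD //.
  by rewrite invMg.
have [y Dy nty] : exists2 y, y \in D & y != 1.
  by apply/trivgPn; rewrite -cardG_gt1 oD; have := Syl2_card_gt2; case: #|P| => [|[]].
have sDB : D \subset B := subsetIl _ _; have sDG := subset_trans sDB sBG.
have Gy : y \in G^# by rewrite !inE nty (subsetP sDG).
have pry := poG Gy.
suffices -> : D :=: <[y]> by [].
apply/eqP; rewrite eqEsubset cycle_subG Dy andbT; apply/subsetP=> z Dz.
apply: contraNT Syl2_neq1 => notYz; apply/eqP.
apply: (@prime_orders_noaction _ G 2 P <[y]>%G z) => //=.
- by rewrite cycle_subG (subsetP sDG).
- exact: (subsetP sDG).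
(* An involution [y] of [D] would lie in [P] and commute with [u], which would put [u] in [P]. *)
- apply/eqP=> oy2; have Iy : y \in I by rewrite inE (subsetP sDG) //= -oy2 orderE.
  have y2 := invD y Dy; rewrite (involutionV Iy) in y2.
  have [Gu _ _ _] := involutionP Iu.
  have P1y : y \in P^# by rewrite !inE nty (involution_norm Iy) ?(subsetP sDB).
  have Pu : u \in P.
    by rewrite -(Syl2_cent1 P1y) inE Gu; apply/cent1P/esym/commgP/conjg_fixP.
  by case/negP: notBu; apply: (subsetP sPB).
- by rewrite cycle_subG; have /setIP[] := subsetP sDB y Dy.
- by have /setIP[] := subsetP sDB z Dz.
by apply: (subsetP (cent_sub _)); rewrite cent_cycle; apply/cent1P/abD.
Qed.

Lemma involution_cent x : x \in I ->
  2.-Sylow(G) 'C_G[x] /\ {in 'C_G[x]^#, forall y, 'C_G[y] = 'C_G[x]}.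
Proof.
rewrite involution_support => /imset2P[t g P1t Gg ->].
have CJ y : 'C_G[y ^ g] = 'C_G[y] :^ g by rewrite cent1J -{1}(conjGid Gg) -conjIg.
rewrite CJ (Syl2_cent1 P1t) pHallJ //; split=> // y; rewrite -conjD1g => /imsetP[z P1z ->].
by rewrite CJ Syl2_cent1.
Qed.

Lemma involution_cent_norm x v : x \in I -> v \in I -> 'C_G[x] :^ v = 'C_G[x] -> v \in 'C_G[x].
Proof.
move=> Ix Iv nCv; have [sylC _] := involution_cent Ix; have [Gv _ _ elv] := involutionP Iv.
have sylCN : 2.-Sylow('N_G('C_G[x])) 'C_G[x].
  by apply: pHall_subl sylC; rewrite ?subsetIl // subsetI subsetIl normG.
rewrite -cycle_subG (sub_normal_Hall sylCN) ?normalSG ?subsetIl // cycle_subG inE Gv.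
exact/normP.
Qed.

(* With t = v x1 and s = v x2, the relations (vt)^3 = (vs)^3 = 1 give
   t^w = s for w = (ts)^v, so that w and then v normalise the common
   centraliser of t and s. *)
Lemma involution_order3 v x1 x2 :
    v \in I -> x1 \in G -> x2 \in G -> x1 ^ v = x1^-1 -> x2 ^ v = x2^-1 ->
    x1 ^+ 3 = 1 -> x2 ^+ 3 = 1 -> v * x1 \in I -> v * x2 \in I -> x1 != 1 ->
    'C_G[v * x1] = 'C_G[v * x2] ->
  x1 = x2.
Proof.
move=> Iv Gx1 Gx2 x1v x2v x13 x23 It Is ntx1 eqC.
set t := v * x1 in It eqC; set s := v * x2 in Is eqC.
have vV := involutionV Iv; have [Gv _ v2 _] := involutionP Iv.
have vv : v * v = 1 by rewrite -{1}vV mulVg.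
have tV := involutionV It; have sV := involutionV Is.
have [Gt ntt _ _] := involutionP It; have [Gs _ _ _] := involutionP Is.
apply/(mulgI v)/eqP; rewrite -/t -/s; apply: contraT => neq_ts.
(* As [v * (v * x) = x] has cube 1, [t = v * x] satisfies [v t v = t v t]. *)
have braid x : x ^ v = x^-1 -> x ^+ 3 = 1 -> v * x \in I -> (v * x) ^ v = v * x * v * (v * x).
  move=> xv x3; have vJ : v ^ v = v by rewrite conjgE mulKg.
  rewrite conjMg xv vJ -[RHS]mulgA (mulgA v v) vv mul1g -mulgA => _; congr (v * _).
  by apply/eqP; rewrite eq_invg_mul -x3 !expgS expg0 mulg1.
have CJ y z : z \in G -> 'C_G[y ^ z] = 'C_G[y] :^ z.
  by move=> Gz; rewrite cent1J -{1}(conjGid Gz) -conjIg.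
have [sylC centC] := involution_cent It; set R := 'C_G[t] in sylC centC.
have Rt : t \in R by rewrite inE Gt cent1id.
have Rs : s \in R by rewrite /R eqC inE Gs cent1id.
have Rts : t * s \in R by rewrite groupM.
have nt_ts : t * s != 1 by rewrite -eq_invg_mul tV.
have R1ts : t * s \in R^# by apply/setD1P.
have Its : t * s \in I.
  by apply: involution_Syl2 nt_ts (mem_p_elt (pHall_pgroup sylC) Rts); rewrite groupM.
pose w := (t * s) ^ v.
have Iw : w \in I.
  by case/involutionP: Its => Gts _ _ elts; apply: involution_Syl2; rewrite ?groupJ ?conjg_eq1 ?p_eltJ.
have [Gw ntw _ _] := involutionP Iw.
have Dw : w = t * w * s.
  rewrite /w {1}conjMg (braid x1) // (braid x2) // -/t -/s [in RHS]conjgE vV !mulgA.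
  by [].
have tt : t * t = 1 by rewrite -[X in X * _]tV mulVg.
have tw : t ^ w = s.
  by apply: (mulgI w); rewrite -conjgC [in LHS]Dw -(mulgA t w s) (mulgA t t) tt mul1g.
have Rw : w \in R.
  by apply: involution_cent_norm => //; rewrite -CJ // tw.
have Rv : v \in R.
  apply: involution_cent_norm => //.
  by rewrite -/R -{1}(centC _ R1ts) -CJ // centC //; apply/setD1P.
have cvt : v * t = t * v by case/setIP: Rv => _ /cent1P.
have Dx1 : x1 = v * t by rewrite /t mulgA vv mul1g.
have x1E : x1^-1 = x1 by rewrite -x1v conjgE vV Dx1 {1}cvt -(mulgA t) vv mulg1.
have xx : x1 * x1 = 1 by rewrite -{1}x1E mulVg.
by case/eqP: ntx1; have := x13; rewrite !expgS expg0 mulg1 xx mulg1.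
Qed.

(** * The configuration of order q (q + 1) (q + 2) *)

Section Configuration.

Variable u : gT.
Let q := #|P|.-1.
Let D := (B :&: B :^ u)%G.
Hypotheses (Iu : u \in I) (notBu : u \notin B) (q_pr : prime q) (oD : #|D| = q).
Hypothesis invD : {in D, forall y, y ^ u = y^-1}.

Let oP : #|P| = q.+1. Proof. by rewrite prednK ?cardG_gt0. Qed.
Let Gu : u \in G. Proof. by case/involutionP: Iu. Qed.
Let sDB : D \subset B. Proof. exact: subsetIl. Qed.
Let sDG : D \subset G. Proof. exact: subset_trans sDB sBG. Qed.

Lemma config_odd : odd q.
Proof.
have: ~~ odd #|P|; last by rewrite oP /= negbK.
by rewrite -dvdn2; case: (pgroup_pdiv pP Syl2_neq1).
Qed.

Let q_gt2 : 2 < q. Proof. exact: odd_prime_gt2 config_odd q_pr. Qed.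

Let D_order y : y \in D^# -> #[y] = q /\ D :=: <[y]>.
Proof.
case/setD1P=> nty Dy; have sYD : <[y]> \subset D by rewrite cycle_subG.
have := cardSg sYD; rewrite oD => /(primeP q_pr).2; rewrite -orderE order_eq1 (negPf nty) /=.
move/eqP=> oy; split=> //; apply/eqP; rewrite eq_sym eqEcard sYD oD -oy leqnn //.
Qed.

Let cDD : abelian D.
Proof. by apply: cyclic_abelian; rewrite prime_cyclic // oD. Qed.

Lemma config_trivIset : P :&: D = 1.
Proof.
apply: coprime_TIg; rewrite oD (pnat_coprime pP) // -odd_2'nat; exact: config_odd.
Qed.

(** [B] acts on the [q] elements of [P^#] with stabilisers [P], so [#|B : P| <= q]; the subset
    [P * D] shows equality. *)
Lemma card_norm_Syl2 : #|B| = (q.+1 * q)%N.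
Proof.
have [t Pt ntt] := trivgPn _ Syl2_neq1.
have P1t : t \in P^# by rewrite !inE ntt.
apply/eqP; rewrite eqn_leq -{2}oP -oD -(TI_cardMg config_trivIset) subset_leq_card; last first.
  by rewrite mul_subG.
rewrite andbT oD -oP -(Lagrange sPB) leq_pmul2l ?cardG_gt0 //.
have <- : 'C_B[t] = P.
  apply/eqP; rewrite eqEsubset subsetI sPB sub_cent1 (subsetP cPP) // andbT.
  by rewrite -(Syl2_cent1 P1t) setSI.
rewrite index_cent1 [q](_ : _ = #|P^#|); last by rewrite /q (cardsD1 1 P) group1.
apply: subset_leq_card; apply/subsetP=> _ /imsetP[b Bb ->].
by rewrite memJ_norm // normD1; case/setIP: Bb.
Qed.

(** Elements of [P] normalising [D] commute with it, since the commutators lie in [P :&: D]; but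
    orders 2 and [q] exclude commuting. So ['N_B(D)] meets [P] trivially and has order at most
    [q]. *)
Lemma config_norm_meet : 'N_B(D) = D.
Proof.
apply/eqP; rewrite eq_sym eqEcard subsetI sDB normG /=.
have tiP : P :&: 'N_B(D) = 1.
  apply/trivgP/subsetP=> x /setIP[Px /setIP[_ nDx]]; rewrite inE.
  have [y Dy nty] : exists2 y, y \in D & y != 1.
    by apply/trivgPn; rewrite -cardG_gt1 oD prime_gt1.
  have D1y : y \in D^# by apply/setD1P.
  apply: contraT => ntx; have cxy : commute x y.
    apply/commgP; rewrite -in_set1 -[[set 1]]config_trivIset inE; apply/andP; split.
      rewrite commgEl groupM ?groupV // memJ_norm //.
      by have /setIP[] := subsetP sDB y Dy.
    by rewrite commgEr groupMr // memJ_norm // groupV.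
  have Px1 : x \in G^# by rewrite !inE ntx (subsetP sPG).
  have Gy : y \in G^# by rewrite !inE nty (subsetP sDG).
  have := prime_orders_commute poG Px1 Gy cxy.
  rewrite (D_order D1y).1 (@prime_orders_pelt _ G 2) ?(mem_p_elt pP Px) // => q2.
  by have := q_gt2; rewrite -q2.
rewrite oD -(leq_pmul2l (cardG_gt0 P)) -(TI_cardMg tiP) oP -card_norm_Syl2.
by rewrite subset_leq_card // mul_subG // subsetIl.
Qed.

(* An element x outside B centralising D would share its coset with an
   involution v, and v x^-1 normalises D inside B, hence lies in D; then v
   would both centralise and invert D. *)
Lemma config_cent : 'C_G(D) = D.
Proof.
apply/eqP; rewrite eq_sym eqEsubset subsetI sDG -abelianE cDD /=.
apply/subsetP=> x /setIP[Gx cDx].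
have [Bx | notBx] := boolP (x \in B).
  by rewrite -config_norm_meet inE Bx (subsetP (cent_sub D)).
have [v [Iv Bxv oDv invDv]] := coset_involution Gx notBx.
have [Gv _ _ _] := involutionP Iv.
have DE : B :&: B :^ v = D.
  apply/esym/eqP; rewrite eqEcard oDv oD leqnn andbT subsetI sDB (eqBx Bxv).
  by rewrite -(normP (subsetP (cent_sub D) x cDx)) conjSg.
have [b Bb Dv] := rcosetP Bxv.
have nDv : v \in 'N(D).
  rewrite inE; apply/subsetP=> _ /imsetP[y Dy ->].
  by rewrite invDv ?DE // groupV.
have Db : b \in D.
  rewrite -config_norm_meet inE Bb -(mulgK x b) -Dv groupM ?groupV //.
  exact: subsetP (cent_sub D) x cDx.
have [y Dy nty] : exists2 y, y \in D & y != 1.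
  by apply/trivgPn; rewrite -cardG_gt1 oD prime_gt1.
have yVy : y = y^-1.
  rewrite -invDv ?DE // Dv conjgM.
  have /conjg_fixP -> : [~ y, b] == 1 by apply/commgP/(centsP cDD).
  by apply/esym/conjg_fixP/commgP/esym; apply: (centP cDx).
have D1y : y \in D^# by apply/setD1P.
have y2 : y ^+ 2 = 1 by rewrite expgS expg1 {1}yVy mulVg.
have : #[y] %| 2 by rewrite order_dvdn y2.
by rewrite (D_order D1y).1 => /(dvdn_leq (isT : 0 < 2)); rewrite leqNgt q_gt2.
Qed.

(** The involution [v] of [B :* x] also inverts [D], so [v * u^-1] centralises [D] and lies in [D]
    by [config_cent]. *)
Lemma config_coset x : x \in G -> x \notin B -> D \subset B :^ x -> x \in B :* u.
Proof.
move=> Gx notBx sDBx; have [v [Iv Bxv oDv invDv]] := coset_involution Gx notBx.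
have [Gv _ _ _] := involutionP Iv.
have DE : B :&: B :^ v = D.
  by apply/esym/eqP; rewrite eqEcard oDv oD leqnn andbT subsetI sDB (eqBx Bxv).
have Dvu : v * u^-1 \in D.
  rewrite -config_cent inE groupM ?groupV //; apply/centP=> y Dy; apply/esym/commgP/conjg_fixP.
  by rewrite conjgM invDv ?DE // (involutionV Iu) conjVg invD // invgK.
have Bvu : v * u^-1 \in B := subsetP sDB _ Dvu.
have Bvx : x * v^-1 \in B by rewrite -mem_rcoset rcoset_sym.
by rewrite mem_rcoset -(mulgKV v x) -mulgA groupM.
Qed.

Lemma config_norm : u \in 'N(D).
Proof.
by rewrite inE; apply/subsetP=> _ /imsetP[y Dy ->]; rewrite invD // groupV.
Qed.

Lemma card_config_norm : #|'N_G(D)| = q.*2.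
Proof.
have -> : 'N_G(D) = D :|: D :* u.
  apply/setP=> x; rewrite in_setU mem_rcoset; apply/setIP/orP=> [[Gx nDx] | Dx].
    have [Bx | notBx] := boolP (x \in B); [left | right].
      by rewrite -config_norm_meet inE Bx.
    have Bxu : x \in B :* u by rewrite config_coset // -(normP nDx) conjSg.
    by rewrite -config_norm_meet inE -mem_rcoset Bxu groupM ?groupV ?config_norm.
  case: Dx => Dx; first by rewrite (subsetP sDG) // (subsetP (normG D)).
  split; rewrite -(mulgKV u x) groupM ?config_norm //; first exact: (subsetP sDG).
  exact: (subsetP (normG D)).
rewrite cardsU card_rcoset oD disjoint_setI0 ?cards0 ?subn0 ?addnn //.
rewrite disjoints_subset; apply/subsetP=> x Dx; rewrite inE mem_rcoset.
rewrite groupMl // groupV; apply: contra notBu; exact: (subsetP sDB).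
Qed.

(** [G] is the disjoint union of [B] and [B u B]: for [x] outside [B], [B :&: B :^ x] and [D] are
    Sylow subgroups of [B], and conjugating one to the other allows [config_coset]. The double coset
    has [#|B|^2 / q] elements. *)
Lemma card_config : #|G| = (q.+1 * q * q.+2)%N.
Proof.
have sylq (E : {group gT}) : E \subset B -> #|E| = q -> q.-Sylow(B) E.
  move=> sEB oE; have q'n : q^'.-nat q.+1 by rewrite p'natE // -prime_coprime // coprimenS.
  have q_part : ((q.+1 * q)`_q = q)%N.
    rewrite (partnM _ (ltn0Sn q) (prime_gt0 q_pr)).
    by rewrite (part_p'nat q'n) mul1n part_pnat_id ?pnat_id.
  by rewrite pHallE sEB oE card_norm_Syl2 q_part eqxx.
have defG : G :=: B :|: B :* u * B.
  apply/eqP; rewrite eqEsubset subUset sBG mul_subG ?mul_subG ?sub1set ?andbT //.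
  apply/subsetP=> x Gx; rewrite in_setU; have [//|notBx /=] := boolP (x \in B).
  have [v [Iv Bxv oDv _]] := coset_involution Gx notBx.
  rewrite (eqBx Bxv) in oDv.
  have [b Bb DE] := Sylow_trans (sylq (B :&: B :^ x)%G (subsetIl _ _) oDv) (sylq D sDB oD).
  have Bxb : x * b \in B :* u.
    have Gxb : x * b \in G by rewrite groupM // (subsetP sBG).
    have notBxb : x * b \notin B by rewrite groupMr.
    by apply: (config_coset Gxb notBxb); rewrite DE conjIg conjsgM subsetIr.
  by rewrite -(mulgK b x) mem_mulg ?groupV.
have oBuB : #|B :* u * B| = (q.+1 * #|B|)%N.
  have -> : #|B :* u * B| = #|B :^ u * B|.
    by rewrite conjsgE -mulgA -mulgA card_lcoset mulgA.
  have := mul_cardG (B :^ u) B; rewrite cardJg setIC oD [in LHS]card_norm_Syl2 => oBB.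
  by apply/eqP; rewrite -(eqn_pmul2r (prime_gt0 q_pr)) -oBB mulnAC card_norm_Syl2 mulnA.
rewrite [in LHS]defG cardsU oBuB disjoint_setI0 ?cards0 ?subn0.
  by rewrite card_norm_Syl2 -mulSn mulnC.
rewrite -setI_eq0; apply/eqP/setP=> x; rewrite in_setI in_set0.
apply/negP=> /andP[Bx /mulsgP[_ b /rcosetP[c Bc ->] Bb Dx]].
by case/negP: notBu; rewrite -(groupMl u Bc) -(groupMr _ Bb) -Dx.
Qed.

(* E below consists of the elements whose order is neither 1, 2 nor q.  Bounding
   #|inv x| by the order of a centraliser on each piece of G, the bounds add up
   exactly to the number of pairs (x, v), so they are all attained.  Then
   #|'C_G[x]| = q + 2 on E. *)
Let inv x := [set v in I | x ^ v == x^-1].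

(** Two elements inverting [x] differ by one that centralises it. *)
Let card_inv_le x : #|inv x| <= #|'C_G[x]|.
Proof.
have [-> | [v0]] := set_0Vmem (inv x); first by rewrite cards0.
case/setIdP=> Iv0 /eqP xv0; have [Gv0 _ _ _] := involutionP Iv0.
rewrite -[leqRHS](card_rcoset _ v0); apply/subset_leq_card/subsetP=> v.
case/setIdP=> Iv /eqP xv; have [Gv _ _ _] := involutionP Iv.
rewrite mem_rcoset (involutionV Iv0) inE groupM //=.
by rewrite cent1C; apply/cent1P/commgP/conjg_fixP; rewrite conjgM xv conjVg xv0 invgK.
Qed.

Let index_B : #|G : B| = q.+2.
Proof.
apply/eqP; rewrite -(eqn_pmul2l (cardG_gt0 B)) Lagrange //.
by rewrite [X in X == _]card_config card_norm_Syl2.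
Qed.

Let c := (q * q.+2)%N.
Let oI : #|I| = c. Proof. by rewrite card_involution index_B. Qed.

(** For fixed [v], the condition [x ^ v = x^-1] amounts to [(v * x) ^+ 2 = 1], with [c + 1]
    solutions. *)
Let sum_inv : (\sum_(x in G) #|inv x| = c * c.+1)%N.
Proof.
rewrite (eq_bigr (fun x : gT => \sum_(v in I | (x ^ v == x^-1)%g) 1)%N) => [|x _]; last first.
  by rewrite sum1dep_card; apply: eq_card => v; rewrite !inE.
rewrite (exchange_big_dep (mem I)) /=; last by move=> x v _ /andP[].
rewrite -{1}oI -sum_nat_const; apply: eq_bigr => v Iv; have [Gv _ _ _] := involutionP Iv.
have vV := involutionV Iv; have vv : v * v = 1 by rewrite -{1}vV mulVg.
have <- : #|v *: (1 |: I)| = c.+1 by rewrite card_lcoset cardsU1 oI inE order1 andbF.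
rewrite sum1dep_card; apply: eq_card => x; rewrite mem_lcoset vV unfold_in /= Iv /= in_setU1.
rewrite -[LHS]/(x \in [set y in G | y ^ v == y^-1]).
have E : (x ^ v == x^-1) = ((v * x) ^+ 2 == 1).
  by rewrite eq_mulgV1 invgK conjgE vV expgS expg1 !mulgA.
apply/setIdP/orP=> [[Gx xv] | [/eqP vx1 | Ivx]]; first last.
- have [Gvx _ vx2 _] := involutionP Ivx; split; last by rewrite /= E vx2.
  by rewrite -(groupMl x Gv).
- have -> : x = v by apply: (mulgI v); rewrite vx1 vv.
  by split; rewrite //= conjgE mulKg vV.
have [|ntvx] := eqVneq (v * x) 1; [by left | right].
rewrite inE groupM //=; apply/eqP/nt_prime_order => //.
by apply/eqP; rewrite -E.
Qed.

Let Q := class_support D^# G.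
Let E := (G^# :\: I) :\: Q.

Let normedTI_D : normedTI D^# G 'N_G(D).
Proof.
apply/normedTI_P; split.
- by rewrite setD_eq0 subG1 -cardG_gt1 oD prime_gt1.
- by rewrite normD1.
move=> g Gg; rewrite -setI_eq0 => /set0Pn[x /setIP[D1x /imsetP[y D1y Dx]]].
rewrite inE Gg; apply/normP.
by rewrite {1}(D_order D1y).2 -cycleJ -Dx -(D_order D1x).2.
Qed.

Let oQ : (2 * #|Q| = q.-1 * (q.+1 * q.+2))%N.
Proof.
rewrite (card_support_normedTI normedTI_D).
have -> : #|D^#| = q.-1 by rewrite -oD (cardsD1 1 D) group1.
rewrite mulnCA; congr (_ * _)%N; apply/eqP.
rewrite -(eqn_pmul2l (prime_gt0 q_pr)) mulnA [(q * 2)%N]muln2 -card_config_norm.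
by rewrite Lagrange ?subsetIl // [X in X == _]card_config; apply/eqP; ring.
Qed.

Let card_cent_Q x : x \in Q -> #|'C_G[x]| = q.
Proof.
case/imset2P=> y g D1y Gg ->.
rewrite cent1J -{1}(conjGid Gg) -conjIg cardJg -cent_cycle -(D_order D1y).2.
by rewrite config_cent oD.
Qed.

(** Inverting an involution is centralising it; leaving out the identity improves [card_inv_le] by
    one. *)
Let inv_I x : x \in I -> #|inv x| <= q.
Proof.
move=> Ix; have [sylC _] := involution_cent Ix.
rewrite (_ : q = #|'C_G[x]^#|); last first.
  by rewrite /q (card_Hall sylP) -(card_Hall sylC) (cardsD1 1 'C_G[x]) group1.
apply/subset_leq_card/subsetP=> v /setIdP[Iv /eqP xv].
have [Gv ntv _ _] := involutionP Iv; apply/setD1P; split=> //.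
by rewrite inE Gv cent1C; apply/cent1P/commgP/conjg_fixP; rewrite xv involutionV.
Qed.

Let sylD : q.-Sylow(G) D.
Proof.
have q'n : q^'.-nat (q.+1 * q.+2)%N.
  rewrite p'natE // Euclid_dvdM // -[q.+2]addn2 -[q.+1]addn1 !dvdn_addr //.
  by rewrite dvdn1 (gtn_eqF (prime_gt1 q_pr)) gtnNdvd.
have q_part : ((q.+1 * q.+2 * q)`_q = q)%N.
  rewrite (@partnM _ (q.+1 * q.+2) _ isT (prime_gt0 q_pr)).
  by rewrite (part_p'nat q'n) mul1n part_pnat_id ?pnat_id.
by rewrite pHallE sDG oD card_config mulnAC q_part eqxx.
Qed.

(** The order of ['C_G[x]] is a power of a prime other than 2 and [q], hence prime to [(q + 1) q],
    as [q + 1 = #|P|]. *)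
Let cent_E x : x \in E -> #|'C_G[x]| %| q.+2 /\ #[x].-group 'C_G[x].
Proof.
case/setDP=> /setDP[G1x notIx] notQx; have [ntx Gx] := setD1P G1x.
have s_pr := poG G1x; have pC := prime_orders_cent1 poG G1x; split=> //.
have s2 : #[x] != 2 by apply: contra notIx => ox; rewrite inE Gx.
have sq : #[x] != q.
  apply: contra notQx => /eqP ox; have qX : q.-group <[x]> by rewrite /pgroup -orderE ox pnat_id.
  have [|g Gg sXDg] := Sylow_subJ sylD _ qX; first by rewrite cycle_subG.
  apply/imset2P; exists (x ^ g^-1) g => //; last by rewrite conjgKV.
  by apply/setD1P; rewrite conjg_eq1 -mem_conjg -cycle_subG.
have: #|'C_G[x]| %| #|G| by rewrite cardSg ?subsetIl.
rewrite card_config Gauss_dvdr // coprimeMr.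
rewrite !(pnat_coprime pC) //; first by rewrite pnatE // !inE eq_sym.
rewrite -oP; apply: sub_in_pnat pP => r _; rewrite !inE => /eqP->.
by rewrite eq_sym.
Qed.

Let split_G (F : gT -> nat) :
  (\sum_(x in G) F x = F 1%g + \sum_(x in I) F x + \sum_(x in Q) F x + \sum_(x in E) F x)%N.
Proof.
have sIG : I \subset G^#.
  by apply/subsetP=> x /involutionP[Gx ntx _ _]; apply/setD1P.
have sQ : Q \subset G^# :\: I.
  apply/subsetP=> _ /imset2P[y g D1y Gg ->]; have [nty Dy] := setD1P D1y.
  have Gyg : y ^ g \in G by rewrite groupJ // (subsetP sDG).
  apply/setDP; split; first by apply/setD1P; rewrite conjg_eq1.
  by apply/negP=> /setIdP[_]; rewrite orderJ (D_order D1y).1 gtn_eqF.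
rewrite (big_setD1 1) //= (big_setID I) (setIidPr sIG) /=.
by rewrite [X in (_ + (_ + X))%N](big_setID Q) /= (setIidPr sQ) /= !addnA.
Qed.

Let oE : (2 * #|E| = q * q.+1 ^ 2)%N.
Proof.
apply: card_rest_arith (prime_gt0 q_pr) oQ _.
by rewrite -card_config -sum1_card (split_G (fun=> 1%N)) !sum1_card oI.
Qed.

Let card_inv_E x : x \in E -> #|inv x| = q.+2.
Proof.
have leE y : y \in E -> #|inv y| <= q.+2.
  by case/cent_E=> dvC _; apply: leq_trans (card_inv_le y) (dvdn_leq _ dvC).
move=> Ex; apply/eqP; rewrite eqn_leq leE //= leqNgt; apply/negP=> ltx.
have le1 : #|inv 1| <= c.
  by rewrite -oI; apply/subset_leq_card/subsetP=> v /setIdP[].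
have leI : \sum_(x in I) #|inv x| <= c * q.
  by rewrite -oI -sum_nat_const; apply: leq_sum => y; apply: inv_I.
have leQ : \sum_(x in Q) #|inv x| <= #|Q| * q.
  rewrite -sum_nat_const; apply: leq_sum => y Qy; rewrite -(card_cent_Q Qy).
  exact: card_inv_le.
have ltE : \sum_(x in E) #|inv x| < #|E| * q.+2.
  rewrite -sum_nat_const (bigD1 x) //= [ltnRHS](bigD1 x) //= -addSn leq_add //.
  by apply: leq_sum => y /andP[/leE].
apply: sum_inv_arith (prime_gt0 q_pr) oQ oE le1 leI leQ ltE _.
by rewrite -sum_inv (split_G (fun x => #|inv x|)).
Qed.

Let pgroup_index_E x : x \in E -> #[x].-nat q.+2.
Proof.
move=> Ex; have [dvC pC] := cent_E Ex; rewrite (_ : q.+2 = #|'C_G[x]|) //.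
by apply/eqP; rewrite eqn_leq (dvdn_leq _ dvC) // andbT -(card_inv_E Ex) card_inv_le.
Qed.

Let E_order x : x \in E -> [/\ x \in G, x != 1, #[x] != 2 & prime #[x]].
Proof.
case/setDP=> /setDP[G1x notIx] _; have [ntx Gx] := setD1P G1x.
split=> //; last exact: poG.
by apply: contra notIx => ox; rewrite inE Gx.
Qed.

(** By [involution_order3], [x |-> 'C_G[v * x]] is injective. Its values are among the at most
    [q + 2] centralisers of involutions, and ['C_G[v]] is not one of them. *)
Let card_inverted v : v \in I -> {in E, forall x, x ^+ 3 = 1} ->
  #|[set x in E | x ^ v == x^-1]| <= q.+1.
Proof.
move=> Iv E3; have [Gv _ _ _] := involutionP Iv.
have vV := involutionV Iv; have vv : v * v = 1 by rewrite -{1}vV mulVg.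
pose CI := [set 'C_G[t] | t in I].
have CI_mem t : t \in I -> 'C_G[t] \in CI by move=> It; apply/imsetP; exists t.
have oCI : #|CI| <= q.+2.
  rewrite -index_B -card_conjugates; apply/subset_leq_card/subsetP=> _ /imsetP[t It ->].
  move: It; rewrite involution_support => /imset2P[y g P1y Gg ->].
  rewrite cent1J -{1}(conjGid Gg) -conjIg (Syl2_cent1 P1y).
  by apply/imsetP; exists g.
have Ivx x : x \in E -> x ^ v = x^-1 -> v * x \in I.
  move=> Ex xv; have [Gx _ ox2 _] := E_order Ex.
  rewrite inE groupM //=; apply/eqP/nt_prime_order => //.
    by rewrite -(mulVg x) -xv conjgE vV expgS expg1 !mulgA.
  apply: contraNneq ox2 => vx1; have -> : x = v by apply: (mulgI v); rewrite vx1 vv.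
  by case/setIdP: Iv.
have injC : {in [set x in E | x ^ v == x^-1] &, injective (fun x => 'C_G[v * x])}.
  move=> x1 x2 /setIdP[E1 /eqP x1v] /setIdP[E2 /eqP x2v] /= eqC.
  have [[Gx1 ntx1 _ _] [Gx2 _ _ _]] := (E_order E1, E_order E2).
  by apply: (involution_order3 Iv) => //; rewrite ?E3 ?Ivx.
rewrite -(card_in_imset injC) -ltnS; apply: leq_trans oCI.
rewrite [ltnRHS](cardsD1 'C_G[v]) CI_mem // ltnS.
apply/subset_leq_card/subsetP=> _ /imsetP[x /setIdP[Ex /eqP xv] ->].
apply/setD1P; split; last by apply/CI_mem/Ivx.
have [Gx ntx ox2 prx] := E_order Ex; apply: contraNneq ox2 => eqC.
have : v * x \in 'C_G[v] by rewrite -eqC inE groupM ?cent1id.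
rewrite groupMl; last by rewrite inE Gv cent1id.
case/setIP=> _ /cent1P/commgP/conjg_fixP; rewrite xv => xVx.
by apply/eqP/nt_prime_order => //; rewrite expgS expg1 -{1}xVx mulVg.
Qed.

(* If q <> 3 then 3 divides q + 2, which is then a power of 3, and all elements
   of E have order 3; card_inverted now contradicts the count. *)
Lemma config_q3 : q = 3.
Proof.
apply/eqP; apply: contraT => q3.
(* Of three consecutive numbers, [q] is a prime other than 3 and [q + 1] is a power of 2. *)
have dv3 : 3 %| q.+2.
  have := dvdn3_prod q; rewrite !Euclid_dvdM // dvdn_prime2 // eq_sym (negPf q3) /= => /orP[] // dv3q.
  by rewrite -oP in dv3q; have := pgroupP pP 3 isT dv3q.
have [x0 Gx0 ox0] : {x | x \in G & #[x] = 3}.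
  by apply: Cauchy => //; rewrite card_config dvdn_mull.
have Ex0 : x0 \in E.
  have ntx0 : x0 != 1 by rewrite -order_gt1 ox0.
  apply/setDP; split; first by apply/setDP; split; [apply/setD1P | rewrite inE Gx0 ox0].
  apply/negP=> /imset2P[y g D1y Gg Dx0]; case/eqP: q3.
  by rewrite -ox0 Dx0 orderJ (D_order D1y).1.
have E3 : {in E, forall x, x ^+ 3 = 1}.
  move=> x Ex; have [_ _ _ prx] := E_order Ex.
  have := pgroup_index_E Ex; rewrite /pnat => /andP[_ /allP/(_ 3)].
  rewrite mem_primes /= dv3 => /(_ isT); rewrite inE => /eqP ->; exact: expg_order.
have : #|E| * q.+2 <= c * q.+1.
  rewrite -oI -!sum_nat_const.
  have -> : (\sum_(x in E) q.+2 = \sum_(x in E) \sum_(v in I | (x ^ v == x^-1)%g) 1)%N.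
    apply: eq_bigr => x /card_inv_E <-; rewrite sum1dep_card.
    by apply: eq_card => v; rewrite !inE.
  rewrite (exchange_big_dep (mem I)) /=; last by move=> x v _ /andP[].
  apply: leq_sum => v Iv; rewrite (eq_bigl (mem [set x in E | (x ^ v == x^-1)%g])) => [|x].
    by rewrite sum1_card card_inverted.
  by rewrite [RHS]inE [v \in I]Iv.
rewrite -(leq_pmul2l (isT : 0 < 2)) mulnA oE => le_E.
have: q.+1 <= 2.
  have q0 : 0 < q * q.+1 * q.+2 by rewrite !muln_gt0 (prime_gt0 q_pr).
  rewrite -(leq_pmul2l q0); apply: leq_trans (leq_trans le_E _); apply: eq_leq.
    by rewrite -mulnn; ring.
  by rewrite /c; ring.
by rewrite leqNgt ltnS ltnW.
Qed.

End Configuration.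

End EvenNonsolvable.

(** * Identification with the alternating group of degree 5 *)

Lemma acts_perm_ord (aT : finGroupType) (rT : finType) (to : {action aT &-> rT})
    (G : {group aT}) (S : {set rT}) :
  [acts G, on S | to] ->
  exists f : {morphism G >-> {perm 'I_#|S|}}, 'ker f = 'C_G(S | to).
Proof.
move=> actsGS.
pose F g (i : 'I_#|S|) := if g \in G then enum_rank_in (enum_valP i) (to (enum_val i) g) else i.
have FE g i : g \in G -> enum_val (F g i) = to (enum_val i) g.
  move=> Gg; rewrite /F Gg enum_rankK_in //.
  by rewrite (acts_act actsGS Gg) enum_valP.
have injF g : injective (F g).
  have [Gg | /negPf notGg] := boolP (g \in G) => i j; last by rewrite /F notGg.
  by move/(congr1 enum_val); rewrite !FE // => /act_inj/enum_val_inj.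
pose f g := perm (@injF g).
have fM : {in G &, {morph f : x y / x * y}}.
  move=> x y Gx Gy; apply/permP=> i; rewrite permM !permE; apply: enum_val_inj.
  by rewrite !FE ?groupM // actM.
exists (Morphism fM); apply/setP=> x; rewrite /= in_setI [RHS]in_setI.
apply: andb_id2l => Gx; rewrite [LHS]inE; apply/set1P/astabP=> [fx1 a Sa | cSx].
  have := FE x (enum_rank_in Sa a) Gx; rewrite enum_rankK_in // => <-.
  by rewrite -[F x _](permE (@injF x)) -/(f x) [f x]fx1 perm1 enum_rankK_in.
apply/permP=> i; rewrite perm1 permE; apply: enum_val_inj.
by rewrite FE // cSx ?enum_valP.
Qed.

(** The image of [G] on the cosets of [H] has order 60, so it meets the alternating group in a
    subgroup of index at most 2. This is normal, and simplicity makes it everything. *)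
Lemma core_free_isog_Alt5 (gT : finGroupType) (G H : {group gT}) :
  H \subset G -> #|G : H| = 5 -> #|G| = 60 -> gcore H G = 1 -> G \isog 'Alt_('I_5).
Proof.
move=> sHG iGH oG core1.
have [f kerf] : exists f : {morphism G >-> {perm 'I_5}}, 'ker f = 1.
  rewrite -iGH; have [f kerf] := acts_perm_ord (actsRs_rcosets H G).
  by exists f; rewrite kerf astabRs_rcosets core1 setIg1.
have oT : #|'I_5| = 5 by rewrite card_ord.
have injf : 'injm f by rewrite kerf.
have isoG : G \isog f @* G := sub_isog (subxx _) injf.
set A := [group of f @* G].
have oA : #|A| = 60 by rewrite -oG card_injm.
have oAlt : #|'Alt_('I_5)| = 60.
  by apply/eqP; rewrite -(eqn_pmul2l (isT : 0 < 2)) card_Alt oT.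
have oSym : #|A * 'Alt_('I_5)| <= 120.
  by have := max_card [pred x in A * 'Alt_('I_5)]; rewrite card_Sn.
have oI : 30 <= #|A :&: 'Alt_('I_5)|.
  have := mul_cardG A 'Alt_('I_5); rewrite oA oAlt => e.
  by rewrite -(leq_pmul2l (isT : 0 < 120)) (leq_trans _ (leq_mul oSym (leqnn _))) // -e.
have sIAlt : A :&: 'Alt_('I_5) \subset 'Alt_('I_5) := subsetIr _ _.
have nsI : A :&: 'Alt_('I_5) <| 'Alt_('I_5).
  have := Lagrange sIAlt; rewrite oAlt => L.
  have: #|'Alt_('I_5) : A :&: 'Alt_('I_5)| <= 2.
    by rewrite -(leq_pmul2l (isT : 0 < 30)) -[leqRHS]L leq_mul.
  rewrite leq_eqVlt => /orP[/eqP/index2_normal -> // | ].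
  rewrite ltnS => le1; have : 'Alt_('I_5) \subset A :&: 'Alt_('I_5).
    by rewrite -indexg_eq1 eqn_leq le1 indexg_gt0.
  by move=> sAlt; rewrite (_ : A :&: 'Alt_('I_5) = 'Alt_('I_5)) ?normal_refl //;
    apply/eqP; rewrite eqEsubset sIAlt.
have /simpleP[_ simpleA] := simple_Alt5_base oT.
have [I1 | IA] := simpleA _ nsI; first by rewrite I1 cards1 in oI.
rewrite (_ : 'Alt_('I_5) = f @* G) //; apply/eqP; rewrite eqEcard -{1}IA subsetIl.
by rewrite oAlt -[#|f @* G|]/#|A| oA.
Qed.

(** The core of [B] lies in [D], of order 3. Were it nontrivial, [D] would be normal in [G], of
    order 60, while ['N_G(D)] has order 6. *)
Theorem nonsolvable_prime_orders_isog (gT : finGroupType) (G : {group gT}) :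
  prime_orders G -> ~~ solvable G -> G \isog 'Alt_('I_5).
Proof.
move=> poG nsolG; have [P sylP] := Sylow_exists 2 G.
have [u [Iu notBu q_pr oD invD]] := even_configuration poG nsolG sylP.
have q3 := config_q3 poG nsolG sylP Iu notBu q_pr oD invD.
pose B := 'N_G(P)%G; pose D := (B :&: B :^ u)%G.
have oN : #|'N_G(D)| = 6.
  by rewrite [LHS](card_config_norm poG nsolG sylP Iu notBu q_pr oD invD) q3.
have oB : #|B| = 12 by rewrite [LHS](card_norm_Syl2 poG nsolG sylP oD) q3.
have oG := card_config poG nsolG sylP Iu notBu q_pr oD invD; rewrite q3 /= in oG oD.
have sBG : B \subset G := subsetIl _ _.
apply: (core_free_isog_Alt5 sBG) => //.
  by apply/eqP; rewrite -(eqn_pmul2l (cardG_gt0 B)) Lagrange // oB oG.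
have Gu : u \in G by case/setIdP: Iu.
have sKD : gcore B G \subset D.
  by rewrite subsetI gcore_sub -{1}(normsP (gcore_norm B G) u Gu) conjSg gcore_sub.
apply/eqP; apply: contraT => ntK.
have DK : gcore B G = D.
  apply/eqP; rewrite eqEcard sKD /= [leqLHS]oD dvdn_leq ?cardG_gt0 //.
  have := cardSg sKD; rewrite [X in _ %| X]oD => /(primeP (isT : prime 3)).2.
  by rewrite -trivg_card1 (negPf ntK) => /eqP ->.
have nDG : 'N_G(D) = G by apply/setIidPl; rewrite -DK gcore_norm.
by have := congr1 (fun A : {set gT} => #|A|) nDG; rewrite oN oG.
Qed.

(** * Non-maximal cyclic subgroups *)

Lemma prime_orders_exponent (gT : finGroupType) (G : {group gT}) (p : nat) :
  prime_orders G -> p.-group G -> exponent G %| p.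
Proof.
move=> poG pG; apply/exponentP=> x Gx.
by rewrite (prime_orders_expn poG Gx) ?(mem_p_elt pG).
Qed.

Lemma prime_orders_classification (gT : finGroupType) (G : {group gT}) :
    prime_orders G ->
  (exists p, prime p /\ p.-group G /\ exponent G %| p)
  \/ (exists p q (K H : {group gT}),
       [/\ prime p, prime q, p != q, [Frobenius G = K ><| H] &
           [/\ p.-group K, exponent K = p & #|H| = q]])
  \/ G \isog 'Alt_('I_5).
Proof.
move=> poG; have [solG | nsolG] := boolP (solvable G); last first.
  by right; right; apply: nonsolvable_prime_orders_isog.
have [p [S [p_pr sylS nsSG oGS]]] := solvable_prime_orders solG poG.
have [sSG pS p'GS] := and3P sylS.
have p_group r : prime r -> r.-group G -> exists p, prime p /\ p.-group G /\ exponent G %| p.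
  by move=> r_pr rG; exists r; split; [|split; [|apply: prime_orders_exponent]].
case: oGS => [defG | q_pr]; first by left; apply: (p_group p); rewrite -?defG.
have [S1 | ntS] := eqVneq (gval S) 1.
  left; rewrite S1 indexg1 in q_pr; apply: (p_group _ q_pr).
  by rewrite /pgroup pnat_id.
right; left; have poS := prime_ordersS sSG poG.
have [|H frobH] := existsP (_ : [Frobenius G with kernel S]).
  apply/Frobenius_kerP; split=> // [|x S1x].
    rewrite properEneq sSG andbT; apply: contraTneq q_pr => ->.
    by rewrite indexgg.
  have [ntx Sx] := setD1P S1x; have Gx : x \in G^# by rewrite !inE ntx (subsetP sSG).
  rewrite (sub_normal_Hall sylS) ?subsetIl //.
  by have := prime_orders_cent1 poG Gx; rewrite (prime_orders_pelt poG Gx (mem_p_elt pS Sx)).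
have [defG _ _ _ _] := Frobenius_context frobH.
have oH : #|H| = #|G : S|.
  apply/eqP; rewrite -(eqn_pmul2l (cardG_gt0 S)) (sdprod_card defG).
  by rewrite Lagrange.
exists p, #|G : S|, S, H; split=> //.
  by move: p'GS; rewrite pnatE // !inE eq_sym.
split=> //; have [x Sx ntx] := trivgPn _ ntS.
have dve := prime_orders_exponent poS pS.
apply/eqP; rewrite eqn_dvd dve /=.
rewrite -(prime_orders_pelt poS _ (mem_p_elt pS Sx)) ?dvdn_exponent //.
by rewrite !inE ntx.
Qed.

Section MaximalCyclic.

Variables (gT : finGroupType) (G : {group gT}).
Implicit Types (N : {group gT}) (p : nat).

Lemma GminusP g :
  reflect (exists2 h, h \in G & <[g]> \proper <[h]>) (g \in Gminus G).
Proof.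
apply: (iffP setIdP) => [[Gg] | [h Gh pr_gh]].
  rewrite /max_cyclic cycle_subG Gg groupP cycle_cyclic /= negb_forall.
  case/existsP=> D; rewrite negb_imply negbK => /andP[/andP[sDG /cyclicP[h Dh]] pr_gD].
  by exists h; rewrite -?Dh // -cycle_subG -Dh.
have Gg : g \in G by rewrite -cycle_subG (subset_trans (proper_sub pr_gh)) ?cycle_subG.
split=> //; rewrite /max_cyclic cycle_subG Gg groupP cycle_cyclic /= negb_forall.
apply/existsP; exists <[h]>%G.
by rewrite negb_imply negbK /= cycle_subG Gh cycle_cyclic.
Qed.

Lemma Gminus_expg p g : g \in G -> prime p -> p %| #[g] -> g ^+ p \in Gminus G.
Proof.
move=> Gg p_pr dv_p; apply/GminusP; exists g => //.
rewrite properEcard cycleX -!orderE orderXdiv // ltn_Pdiv ?order_gt0 //.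
exact: prime_gt1.
Qed.

Lemma Gminus_constt (pi : nat_pred) g : g \in G -> ~~ pi.-elt g -> g.`_pi \in Gminus G.
Proof.
move=> Gg notpig; apply/GminusP; exists g => //.
rewrite properEneq cycle_subG cycle_constt andbT.
by apply: contraNneq notpig => eqg; rewrite /p_elt orderE -eqg -orderE -/(p_elt _ _) p_elt_constt.
Qed.

Lemma Gminus_sub_p_elt N g :
  Gminus G \subset N -> g \in G :\: N -> exists p, prime p /\ p.-elt g.
Proof.
move=> sGN /setDP[Gg notNg]; have ntg : g != 1 by apply: contraNneq notNg => ->.
pose p := pdiv #[g]; have p_pr : prime p by rewrite pdiv_prime ?order_gt1.
exists p; split=> //; apply: contraNT notNg => notpg.
rewrite -(consttC p g) groupM ?(subsetP sGN) ?Gminus_constt //.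
by rewrite /p_elt p'natE // pdiv_dvd.
Qed.

Lemma Gminus_sub_prime_orders N : Gminus G \subset N -> prime_orders (G / N).
Proof.
move=> sGN xN /setD1P[ntxN /morphimP[x nNx Gx def_xN]].
have notNx : x \notin N by apply: contra ntxN => Nx; rewrite def_xN /= coset_id.
have ntx : x != 1 by apply: contraNneq notNx => ->.
have p_pr : prime (pdiv #[x]) by rewrite pdiv_prime ?order_gt1.
suffices -> : #[xN] = pdiv #[x] by [].
apply: nt_prime_order => //; rewrite def_xN -morphX //= coset_id //.
exact/(subsetP sGN)/Gminus_expg/pdiv_dvd.
Qed.

(** If [<[g]>] is properly contained in [<[h]>] with [h] a [p]-element outside [N], then [g] is a
    power of [h ^+ p]. *)
Lemma sub_Gminus N :
    N <| G -> (forall g, g \in G :\: N -> exists2 p, prime p & p.-elt g /\ g ^+ p \in N) ->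
  Gminus G \subset N.
Proof.
move=> nsNG pN; apply/subsetP=> g /GminusP[h Gh /andP[sgh neq_gh]].
have [Nh | notNh] := boolP (h \in N).
  by rewrite -cycle_subG (subset_trans sgh) ?cycle_subG.
have [|p p_pr [p_h Nhp]] := pN h; first by rewrite inE notNh.
have /cycleP[i Dg] : g \in <[h]> by rewrite -cycle_subG.
have [/dvdnP[k Di] | p'i] := boolP (p %| i).
  by rewrite Dg Di mulnC expgM groupX.
case/negP: neq_gh; have : generator <[h]> g.
  by rewrite Dg generator_coprime (pnat_coprime p_h) // p'natE.
by move/eqP=> {1}->.
Qed.

End MaximalCyclic.

Theorem theorem3p2 (gT : finGroupType) (G : {group gT}) :
  (* (1) *)
  (forall N : {group gT}, N <| G ->
     ((Gminus G \subset N) <->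
        ((forall g, g \in G :\: N -> exists p, prime p /\ p.-elt g) /\
         (forall x, x \in (G / N)^# -> prime #[x])))
     /\
     (Gminus G \subset N ->
        (exists p, prime p /\ p.-group (G / N) /\ exponent (G / N) %| p)
        \/
        (exists p q (K H : {group coset_of N}),
            [/\ prime p, prime q, p != q,
                [Frobenius (G / N) = K ><| H] &
                [/\ p.-group K, exponent K = p & #|H| = q]])
        \/
        (G / N \isog 'Alt_('I_5))))
  /\
  (* (2) *)
  (forall (M : {group gT}) (p : nat), prime p -> M <| G -> #|G : M| = p ->
     ((Gminus G \subset M) <-> (forall g, g \in G :\: M -> p.-elt g)))
  /\
  (* (3) *)
  (forall (p : nat) (N : {group gT}), prime p -> p.-group G -> N <| G ->
     exponent (G / N) = p -> Gminus G \subset N).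
Proof.
have coset_pelt (N : {group gT}) p g : N <| G -> g \in G :\: N -> p.-elt g ->
    [/\ g \in 'N(N), coset N g \in (G / N)^# & p.-elt (coset N g)].
  move=> nsNG /setDP[Gg notNg] p_g; have nNg := subsetP (normal_norm nsNG) g Gg.
  split; rewrite ?morph_p_elt // !inE mem_quotient // andbT.
  by apply: contra notNg => /eqP; apply: coset_idr.
split; [move=> N nsNG | split=> [M p p_pr nsMG iMG | p N p_pr pG nsNG expGN]].
- split=> [|sGN]; last exact/prime_orders_classification/Gminus_sub_prime_orders.
  split=> [sGN | [p_elts poGN]].
    by split=> [g /(Gminus_sub_p_elt sGN) // | x]; apply: Gminus_sub_prime_orders.
  apply: sub_Gminus => // g GNg; have [p [p_pr p_g]] := p_elts g GNg.
  exists p; rewrite // p_g; split=> //.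
  have [nNg GNbg p_bg] := coset_pelt N p g nsNG GNg p_g.
  apply: coset_idr; rewrite ?groupX // morphX //=.
  by rewrite -(prime_orders_pelt poGN GNbg p_bg) expg_order.
- have GMp x : x \in G / M -> x ^+ p = 1.
    move=> GMx; have := order_dvdG GMx; rewrite card_quotient ?normal_norm // iMG.
    by rewrite order_dvdn => /eqP.
  split=> [sGM g GMg | p_elts]; last first.
    apply: sub_Gminus => // g GMg; exists p; rewrite // p_elts //; split=> //.
    have [nMg /setD1P[_ Gbg] _] := coset_pelt M p g nsMG GMg (p_elts g GMg).
    by apply: coset_idr; rewrite ?groupX // morphX //= GMp.
  have [r [r_pr r_g]] := Gminus_sub_p_elt sGM GMg.
  have [nMg /setD1P[ntbg Gbg] r_bg] := coset_pelt M r g nsMG GMg r_g.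
  (* The image of [g] is an [r]-element whose order is the index [p]. *)
  suffices -> : p = r by [].
  have obg : #[coset M g] = p by apply: nt_prime_order => //; apply: GMp.
  by move: r_bg; rewrite /p_elt obg pnatE // => /eqP.
apply: sub_Gminus => // g GNg; exists p => //; have [Gg _] := setDP GNg.
have p_g := mem_p_elt pG Gg; split=> //.
have [nNg /setD1P[_ Gbg] _] := coset_pelt N p g nsNG GNg p_g.
by apply: coset_idr; rewrite ?groupX // morphX //= -expGN expg_exponent.
Qed.
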